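(* Consider the opaque selling model with the semi-dynamic policy $\pi^d$ with constant parameter $c_d$, $0<c_d\le\frac{1}{10\binom N2}$, and let the opaque discount $\delta$ be a constant independent of $S$ (i.e. $\delta\in\Theta(1)$). Then, as $S\to\infty$ with $N,\bar v,\gamma$ fixed, $K\in\Theta(S)$ and $h\in\Theta(1/S)$: (i) $\mathbb{E}[M^d]\in\mathcal{O}(\sqrt S)$ and $\mathbb{E}[R^d]=NS-\theta_d$, where $\theta_d\in\mathcal{O}(1)$. (ii) $Rev^d=\hat p-\delta\left(1-\frac N2+\frac{2N\delta}{\gamma}\right)\xi_d^1$ and $Inv^d=\frac{K}{NS}+\frac h2\cdot NS+\xi_d^2$, where $\xi_d^1\in\mathcal{O}\left(\frac1{\sqrt S}\right)$ and $\xi_d^2\in\mathcal{O}\left(\frac1S\right)$.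
   Context: Opaque selling model. $N\ge2$ is even; a retailer sells $N$ products over an infinite discrete horizon, one customer arriving per period. Product $i\in[N-1]$ has characteristic $x_i=i/N$ and $x_N=0$. Each customer independently draws $X\sim U[0,1]$; her value for product $i$ is $V_i=\bar v-\gamma\, d(X,x_i)$ with $d(X,x)=\min\{|X-x|,1-|X-x|\}$, $0<\gamma\le \bar vN$, $\bar v>\gamma/4$. Each individual product has price $\hat p=\bar v-\frac{\gamma}{2N}$ (marginal cost zero). When offered, the opaque product has price $\hat p-\delta$ and is valued at $V_o=\frac1N\sum_{i=1}^N V_i$, with $\delta\in\left(\left(\frac14-\frac1{2N}\right)\gamma,\ \min\{\frac\gamma4,\hat p\}\right]$. The customer buys the opaque product, if offered, when $V_o-(\hat p-\delta)\ge\max\{\max_i V_i-\hat p,0\}$; otherwise she buys an individual product maximizing $V_i-\hat p$ (lexicographic ties) if this maximum is nonnegative, and else nothing. Put $q_o=1-\frac N2+\frac{2N\delta}{\gamma}$ (the probability that the opaque product is bought when offered). If the opaque product is bought, a uniformly random pair $\mathcal F(t)$ of distinct products is drawn and the one with larger remaining inventory is allocated (lexicographic ties). Inventory: each product starts a replenishment cycle with inventory $S$; as soon as some product's inventory reaches $0$, all products are replenished to $S$ at fixed cost $K>0$ and a new cycle begins; holding cost is $h>0$ per unit of on-hand inventory per period. Under policy $\pi$, $R^\pi$ is the (random) length of a replenishment cycle and $M^\pi$ the number of opaque purchases in a cycle. $Rev^\pi$ is the long-run average revenue per period, and $Inv^\pi=\frac{K}{\mathbb E[R^\pi]}+\frac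 h2\left(2NS+1-\frac{\mathbb E[(R^\pi)^2]}{\mathbb E[R^\pi]}\right)$ is the long-run average inventory cost per period. Semi-dynamic policy $\pi^d$ (superscript $d$): with $t$ re-initialized in each cycle, $z_i^d(t)$ the inventory of product $i$ after period $t$ of the cycle, $Gap_I^d(t)=S-\frac tN-\min_i z_i^d(t)$ and $T=N(S-1)+1$, the opaque product is not offered until the first $t$ with $Gap^d_I(t)\ge\frac{c_d(T-t)q_o}{N}$; from period $t+1$ until the end of the cycle it is offered in every period. Asymptotic notation is with respect to $S$. *)

(* Defs.v *)
From HB Require Import structures.
From mathcomp Require Import all_boot all_order all_algebra.
From mathcomp Require Import all_classical all_reals all_analysis.

Set Implicit Arguments.
Unset Strict Implicit.
Unset Printing Implicit Defensive.

Import Order.TTheory GRing.Theory Num.Theory.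
Import numFieldNormedType.Exports.

Local Open Scope classical_set_scope.
Local Open Scope ring_scope.

(* The ordinal i : 'I_N stands for product i.+1 of [N]; this preserves the
   order of the labels, hence lexicographic tie-breaking.  Customers are numbered
   from 0: customer k arrives in period k.+1. *)

Section Customer.
Variables (R : realType) (N : nat) (vbar gamma delta : R).

Definition location (i : 'I_N) : R :=
  if i.+1 == N then 0 else i.+1%:R / N%:R.

Definition circ_dist (x y : R) : R := Num.min `|x - y| (1 - `|x - y|).

Definition valuation (x : R) (i : 'I_N) : R :=
  vbar - gamma * circ_dist x (location i).

Definition price : R := vbar - gamma / (2 * N%:R).

Definition opaque_valuation (x : R) : R :=
  N%:R^-1 * \sum_(i < N) valuation x i.

Definition opaque_prob : R := 1 - N%:R / 2 + 2 * N%:R * delta / gamma.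

(* Starting the iterated maximum at 0 gives max {max_i V_i - price, 0}. *)
Definition buys_opaque (offered : bool) (x : R) : bool :=
  offered && (\big[Num.max/0]_(i < N) (valuation x i - price)
              <= opaque_valuation x - (price - delta)).

Definition favourite (x : R) : option 'I_N :=
  [pick i | [&& 0 <= valuation x i - price,
                [forall j, valuation x j <= valuation x i] &
                [forall j : 'I_N, (j < i)%N ==> (valuation x j < valuation x i)]]].

Definition revenue (offered : bool) (x : R) : R :=
  if buys_opaque offered x then price - delta
  else if favourite x is Some _ then price else 0.

Definition inventory := {ffun 'I_N -> nat}.

Definition allocate (z : inventory) (pair : {set 'I_N}) : option 'I_N :=
  [pick i in pair | [forall j in pair,
     (z j < z i)%N || ((z j == z i) && (i <= j)%N)]].

Definition depleted (offered : bool) (z : inventory) (x : R)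
    (pair : {set 'I_N}) : inventory :=
  let sold := if buys_opaque offered x then allocate z pair else favourite x in
  [ffun i => (z i - (sold == Some i))%N].

Definition stockout (z : inventory) : bool := [exists i, z i == 0%N].

End Customer.

Section Policy.
Variables (R : realType) (N : nat).

(* The history of a cycle after its period t is [:: z(1); ...; z(t)]; the
   inventory z(0) at the start of the cycle is full_stock and is left out. *)
Definition history := seq (inventory N).

(* A policy decides from the history up to period t whether the opaque product
   is offered in period t.+1 of the cycle. *)
Definition policy := history -> bool.

Definition full_stock (S : nat) : inventory N := [ffun => S].

Definition stock_after (S : nat) (zs : history) (t : nat) : inventory N :=
  nth (full_stock S) (full_stock S :: zs) t.

(* Inventories never exceed S, so starting the iterated minimum at S is
   harmless. *)
Definition gap (S t : nat) (z : inventory N) : R :=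
  S%:R - t%:R / N%:R - (\big[minn/S]_(i < N) z i)%:R.

Definition horizon (S : nat) : nat := (N * (S - 1) + 1)%N.

Definition semi_dynamic (q c : R) (S : nat) : policy := fun zs =>
  [exists t : 'I_(size zs).+1,
     c * ((horizon S)%:R - t%:R) * q / N%:R <= gap S t (stock_after S zs t)].

End Policy.

Section System.
Variables (R : realType) (N : nat) (vbar gamma delta : R).
Variables (pol : policy N) (S : nat).

Definition extend (zs : history N) (x : R) (pair : {set 'I_N}) : history N :=
  rcons zs (depleted vbar gamma delta (pol zs)
              (stock_after S zs (size zs)) x pair).

Definition replenish (zs : history N) : history N :=
  if stockout (stock_after S zs (size zs)) then [::] else zs.

Section Path.
Variables (x : nat -> R) (pair : nat -> {set 'I_N}).

Fixpoint first_cycle (t : nat) : history N :=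
  if t is s.+1 then extend (first_cycle s) (x s) (pair s) else [::].

(* The value 0 in the absence of a stock-out is immaterial: almost surely every
   customer takes one unit, so that a stock-out occurs within horizon N S
   periods. *)
Definition cycle_length : nat :=
  if pselect (exists t, let zs := first_cycle t in
                        stockout (stock_after S zs (size zs)))
    is left ex then ex_minn ex else 0%N.

Definition opaque_purchases : nat :=
  \sum_(t < cycle_length) buys_opaque N vbar gamma delta (pol (first_cycle t)) (x t).

Fixpoint current_cycle (n : nat) : history N :=
  if n is k.+1 then replenish (extend (current_cycle k) (x k) (pair k))
  else [::].

Definition total_revenue (n : nat) : R :=
  \sum_(k < n) revenue N vbar gamma delta (pol (current_cycle k)) (x k).

End Path.
End System.

Section Randomness.
Context {d : measure_display} {Omega : measurableType d} {R : realType}.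
Variables (P : probability Omega R) (N : nat).
Variables (X : nat -> {RV P >-> R}) (F : nat -> Omega -> {set 'I_N}).

(* F k is the pair drawn in period k.+1; it is only used if the opaque product
   is bought in that period. *)
Definition customer_stream : Prop :=
  [/\ forall k (A : set R), measurable A ->
        distribution P (X k) A = uniform_prob (@ltr01 R) A,
      forall k (B : {set 'I_N}), measurable (F k @^-1` [set B]),
      forall k (B : {set 'I_N}),
        P (F k @^-1` [set B]) = (if #|B| == 2%N then 'C(N, 2)%:R^-1 else 0)%:E &
      forall n (A : nat -> set R) (B : nat -> set {set 'I_N}),
        (forall k, measurable (A k)) ->
        P (\bigcap_(k in `I_n) (X k @^-1` A k `&` F k @^-1` B k)) =
        (\prod_(k < n) (P (X k @^-1` A k) * P (F k @^-1` B k)))%E].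

Variables (vbar gamma delta : R) (pol : policy N) (S : nat).

(* Only applied to variables that are almost surely bounded, whose expectation
   is finite. *)
Definition mean (Y : Omega -> R) : R := fine 'E_P[Y]%E.

Definition R_cycle (w : Omega) : R :=
  (cycle_length vbar gamma delta pol S (X ^~ w) (F ^~ w))%:R.

Definition M_cycle (w : Omega) : R :=
  (opaque_purchases vbar gamma delta pol S (X ^~ w) (F ^~ w))%:R.

Definition inventory_cost (K h : R) : R :=
  K / mean R_cycle
  + h / 2 * (2 * N%:R * S%:R + 1
             - mean (fun w => R_cycle w ^+ 2) / mean R_cycle).

Definition long_run_revenue (r : R) : Prop :=
  ('E_P[(fun w => total_revenue vbar gamma delta pol S (X ^~ w) (F ^~ w) n
                  / n%:R)%R])%E
    @[n --> \oo] --> r%:E.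

End Randomness.

(* Main.v *)
(** Every customer reduces to a finite event (whether she prefers the opaque
    product, her favourite product, the pair drawn for her).  For even N the
    distances from a point of the circle to the N locations sum to N / 4, so the
    opaque product has the constant value [vbar - gamma / 4], and the events are
    i.i.d. with explicit weights: the favourite is uniform and independent of the
    preference for the opaque product.

    Call [S - t / N - z_i] the load of product i after t periods; the loads sum to
    0 and the gap is their maximum.  Let k be the number of periods left before the
    horizon and [a = c q].  As long as the opaque product is not offered, the sum of
    the squared loads grows by at most 1 per period in mean; when the offer starts,
    [a k / N] is at most the gap, so that the mean of k, which bounds the opaque
    sales, is of order [sqrt S].  Once it is offered, the potential
    [sum_i exp (eps * load i)] contracts, and fast enough for
    [exp (- eps a k / N)] times the potential to be a supermartingale up to a
    summable error; this product is bounded when the offer starts and is at least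
    [exp (eps (1 - a) k / N)] at the stock-out, hence the mean of k at the stock-out
    is bounded.  Both arguments are run as backward inductions on k.

    For the revenue, the Poisson equation of the chain of cycle histories shows
    that the mean accumulated revenue stays within a constant of a linear
    function. *)
Require Import Defs.
From HB Require Import structures.
From mathcomp Require Import all_boot all_order all_algebra.
From mathcomp Require Import all_classical all_reals all_analysis.
From mathcomp Require Import measurable_realfun.
From mathcomp Require Import zify ring lra.

Set Implicit Arguments.
Unset Strict Implicit.
Unset Printing Implicit Defensive.

Import Order.TTheory GRing.Theory Num.Theory.
Import numFieldNormedType.Exports.

Local Open Scope classical_set_scope.
Local Open Scope ring_scope.

(** * Finite means *)

Section WeightedMean.
Variables (R : realType) (E : finType) (p : E -> R).
Hypotheses (p_ge0 : forall e, 0 <= p e) (p_sum1 : \sum_e p e = 1).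

Definition avg (f : E -> R) : R := \sum_e p e * f e.

(** The comparison is asked only at positive weight, so later arguments may assume every customer
    event valid. *)
Lemma le_avg (f g : E -> R) :
  (forall e, 0 < p e -> f e <= g e) -> avg f <= avg g.
Proof.
move=> fg; apply: ler_sum => e _.
have := p_ge0 e; rewrite le_eqVlt => /orP[/eqP<-|pe]; first by rewrite !mul0r.
by rewrite ler_wpM2l// ?fg// ltW.
Qed.

Lemma eq_avg (f g : E -> R) :
  (forall e, 0 < p e -> f e = g e) -> avg f = avg g.
Proof.
by move=> fg; apply/eqP; rewrite eq_le !le_avg// => e pe; rewrite fg.
Qed.

Lemma avgD (f g : E -> R) : avg (fun e => f e + g e) = avg f + avg g.
Proof. by rewrite /avg -big_split; apply: eq_bigr => e _; rewrite mulrDr. Qed.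

Lemma avgZ (a : R) (f : E -> R) : avg (fun e => a * f e) = a * avg f.
Proof. by rewrite /avg mulr_sumr; apply: eq_bigr => e _; rewrite mulrCA. Qed.

Lemma avg_cst (a : R) : avg (fun=> a) = a.
Proof. by rewrite /avg -mulr_suml p_sum1 mul1r. Qed.

Lemma avgB (f g : E -> R) : avg (fun e => f e - g e) = avg f - avg g.
Proof.
rewrite avgD; congr (_ + _).
by rewrite (_ : (fun e => - g e) = fun e => (-1) * g e) ?avgZ ?mulN1r//;
   apply/funext => e; rewrite mulN1r.
Qed.

Lemma avg_le_cst (f : E -> R) a : (forall e, 0 < p e -> f e <= a) -> avg f <= a.
Proof. by move=> fa; rewrite -[leRHS]avg_cst; exact: le_avg. Qed.

Lemma avg_ge_cst (f : E -> R) a : (forall e, 0 < p e -> a <= f e) -> a <= avg f.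
Proof. by move=> fa; rewrite -[leLHS]avg_cst; exact: le_avg. Qed.

Fixpoint avg_seq (n : nat) (f : seq E -> R) : R :=
  if n is m.+1 then avg (fun e => avg_seq m (fun es => f (e :: es)))
  else f [::].

Lemma avg_seqD n (f g : seq E -> R) :
  avg_seq n (fun es => f es + g es) = avg_seq n f + avg_seq n g.
Proof.
elim: n f g => [//|n IH] f g /=; rewrite -avgD.
by congr avg; apply/funext => e; rewrite IH.
Qed.

Lemma avg_seqZ n (a : R) (f : seq E -> R) :
  avg_seq n (fun es => a * f es) = a * avg_seq n f.
Proof.
elim: n f => [//|n IH] f /=; rewrite -avgZ.
by congr avg; apply/funext => e; rewrite IH.
Qed.

Lemma avg_seq_cst n (a : R) : avg_seq n (fun=> a) = a.
Proof.
by elim: n => [//|n IH] /=; under [X in avg X]eq_fun do rewrite IH; rewrite avg_cst.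
Qed.

Lemma le_avg_seq n (f g : seq E -> R) :
  (forall es, size es = n -> all (fun e => 0 < p e) es -> f es <= g es) ->
  avg_seq n f <= avg_seq n g.
Proof.
elim: n f g => [|n IH] f g fg /=; first exact: fg.
by apply: le_avg => e pe; apply: IH => es sz pes; apply: fg; rewrite /= ?sz ?pe.
Qed.

(** The recursive form of the mean suits backward induction; the product form matches the law of the
    first [n] events. *)
Lemma avg_seqE n (f : seq E -> R) :
  avg_seq n f = \sum_(t : n.-tuple E) (\prod_(k < n) p (tnth t k)) * f t.
Proof.
elim: n f => [|n IH] f /=.
  rewrite (bigD1 [tuple])//= big_ord0 mul1r big1 ?addr0//.
  by move=> t /negP[]; rewrite tuple0.
transitivity (\sum_e \sum_(t : n.-tuple E)
    p e * ((\prod_(k < n) p (tnth t k)) * f (e :: t))).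
  by apply: eq_bigr => e _; rewrite IH mulr_sumr.
rewrite pair_bigA/=.
rewrite (reindex (fun u : E * n.-tuple E => cons_tuple u.1 u.2))/=; last first.
  exists (fun t : n.+1.-tuple E => (thead t, behead_tuple t)) => [[e t]|t] _ /=.
    by rewrite theadE; congr pair; apply: val_inj.
  by rewrite [RHS]tuple_eta; apply: val_inj.
apply: eq_bigr => -[e t] _ /=; rewrite big_ord_recl/= tnth0 mulrA.
congr (_ * _ * _); apply: eq_bigr => k _; congr p.
by rewrite (tnth_nth e) (tnth_nth e).
Qed.

End WeightedMean.

(** The components are the preference for the opaque product if offered, the favourite product and
    the pair drawn. *)
Definition event (N : nat) : finType := (bool * option 'I_N * {set 'I_N})%type.

(** * Customer events *)

Lemma big_option (R : nmodType) (T : finType) (f : option T -> R) :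
  \sum_o f o = f None + \sum_x f (Some x).
Proof.
rewrite (bigID (fun o : option T => o == None))/= big_pred1_eq; congr (_ + _).
rewrite (reindex_omap (op := +%R) Some id)/=; last by case.
by apply: eq_bigl => i; rewrite eqxx.
Qed.

Section Events.
Variables (R : realType) (N : nat).
Implicit Types (e : event N) (z : inventory N) (s : {set 'I_N}).

Definition sold (offered : bool) z e : option 'I_N :=
  if offered && e.1.1 then allocate z e.2 else e.1.2.

Definition valid e := (e.1.2 != None) && (#|e.2| == 2%N).

Lemma allocateP z s : s != finset.set0 ->
  exists i, [/\ allocate z s = Some i, i \in s &
                forall j, j \in s -> (z j <= z i)%N].
Proof.
move=> /set0Pn[i0 i0s].
(* The largest inventory comes first, then the smallest label [k] among the ties; this witness shows
   that [pick] succeeds. *)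
case: (@arg_maxnP _ i0 (fun i => i \in s) (fun i => z i) i0s) => m ms zm.
have mP : (m \in s) && (z m == z m) by rewrite ms eqxx.
case: (@arg_minnP _ m (fun i => (i \in s) && (z i == z m)) (fun i => i : nat) mP)
  => k /andP[ks /eqP zk] kmin.
have max_k : (k \in s) &&
    [forall j in s, (z j < z k)%N || ((z j == z k) && (k <= j)%N)].
  rewrite ks; apply/forallP => j; apply/implyP => js.
  have := zm _ js; rewrite zk /= leq_eqVlt => /orP[zj|->//].
  by rewrite zj kmin ?orbT// js.
rewrite /allocate; case: pickP => [i /andP[iS /forallP zi]|/(_ k)]; last by rewrite max_k.
exists i; split=> // j js.
by have := zi j; rewrite js /= => /orP[/ltnW//|/andP[/eqP->]].
Qed.

Lemma sold_valid off z e : valid e -> exists i, sold off z e = Some i.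
Proof.
case: e => -[b o] s /andP[/= o0 s2]; rewrite /sold /=.
case: (off && b); last by case: o o0 => // i _; exists i.
have /allocateP -/(_ z)[i [-> _ _]] : s != finset.set0 by rewrite -card_gt0 (eqP s2).
by exists i.
Qed.

Variable q : R.

(** Product law: Bernoulli preference, uniform favourite and uniform pair, all independent. *)
Definition weight e : R :=
  (if e.1.1 then q else 1 - q) * (if e.1.2 is Some _ then N%:R^-1 else 0) *
  (if #|e.2| == 2%N then 'C(N, 2)%:R^-1 else 0).

Lemma avg_weight (f : event N -> R) :
  avg weight f = \sum_b (if b then q else 1 - q) *
    (N%:R^-1 * \sum_i ('C(N, 2)%:R^-1 *
       \sum_(s : {set 'I_N} | #|s| == 2%N) f (b, Some i, s))).
Proof.
rewrite /avg (_ : \sum_e _ =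
    \sum_b \sum_o \sum_s weight (b, o, s) * f (b, o, s)); last first.
  by rewrite !pair_bigA/=; apply: eq_bigr => -[[]].
apply: eq_bigr => b _; rewrite mulr_sumr mulr_sumr.
rewrite big_option big1 ?add0r => [|s _]; last by rewrite /weight /= mulr0 !mul0r.
apply: eq_bigr => i _.
rewrite mulr_sumr [in LHS](bigID (fun s : {set 'I_N} => #|s| == 2%N))/=.
rewrite [X in _ + X]big1 ?addr0 => [|s /negbTE s2]; last first.
  by rewrite /weight /= s2 mulr0 mul0r.
rewrite mulr_sumr mulr_sumr; apply: eq_bigr => s s2; rewrite /weight /= s2.
by rewrite !mulrA.
Qed.

Hypotheses (q_ge0 : 0 <= q) (q_le1 : q <= 1) (N_ge2 : (2 <= N)%N).

Let N_neq0 : N%:R != 0 :> R.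
Proof. by rewrite pnatr_eq0; lia. Qed.

Lemma bin2_gt0 : 0 < 'C(N, 2)%:R :> R.
Proof. by rewrite ltr0n bin_gt0. Qed.

Let C_neq0 : 'C(N, 2)%:R != 0 :> R.
Proof. by rewrite lt0r_neq0// bin2_gt0. Qed.

Lemma sum_pairs_cst (a : R) :
  'C(N, 2)%:R^-1 * (\sum_(s : {set 'I_N} | #|s| == 2%N) a) = a.
Proof.
rewrite sumr_const -cardsE card_draws card_ord -[a *+ _]mulr_natl mulKf//.
Qed.

Lemma mean_products_cst (a : R) : N%:R^-1 * (\sum_(i < N) a) = a.
Proof. by rewrite sumr_const card_ord -[a *+ _]mulr_natl mulKf. Qed.

Lemma weight_ge0 e : 0 <= weight e.
Proof.
rewrite /weight !mulr_ge0//; first by case: ifP => // _; rewrite subr_ge0.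
- by case: e.1.2 => // i; rewrite invr_ge0.
- by case: ifP => // _; rewrite invr_ge0.
Qed.

Lemma weight_valid e : 0 < weight e -> valid e.
Proof.
rewrite /weight /valid; case: e.1.2 => [i|]/=; last by rewrite mulr0 mul0r ltxx.
by case: eqP => // _; rewrite mulr0 ltxx.
Qed.

Lemma weight_sum1 : \sum_e weight e = 1.
Proof.
have := avg_weight (fun=> 1); rewrite /avg; under eq_bigr do rewrite mulr1.
move=> ->; rewrite !big_bool/=.
by rewrite !(eq_bigr _ (fun i _ => sum_pairs_cst 1)) mean_products_cst; ring.
Qed.

Lemma avg_sold off z (g : 'I_N -> R) :
  avg weight (fun e => oapp g 0 (sold off z e)) =
  if off then
    q * ('C(N, 2)%:R^-1 *
         \sum_(s : {set 'I_N} | #|s| == 2%N) oapp g 0 (allocate z s)) +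
    (1 - q) * (N%:R^-1 * \sum_i g i)
  else N%:R^-1 * \sum_i g i.
Proof.
rewrite avg_weight big_bool/=.
have favE : N%:R^-1 * (\sum_i 'C(N, 2)%:R^-1 *
    \sum_(s : {set 'I_N} | #|s| == 2%N) oapp g 0 (sold false z (false, Some i, s))) =
    N%:R^-1 * \sum_i g i.
  by congr (_ * _); apply: eq_bigr => i _; rewrite /= sum_pairs_cst.
case: off; rewrite /sold /=; last by rewrite favE; ring.
by rewrite mean_products_cst favE.
Qed.

Lemma card_pairs_containing (i : 'I_N) :
  #|[pred s : {set 'I_N} | (#|s| == 2%N) && (i \in s)]| = N.-1.
Proof.
have inj : {in predC1 i &, injective (fun j => [set i; j]%SET)}.
  move=> j k; rewrite !inE => ji _ /setP/(_ j).
  by rewrite !inE eqxx orbT (negbTE ji) => /esym/eqP.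
rewrite -[RHS](_ : #|predC1 i| = _); last by rewrite cardC1 card_ord.
rewrite -(card_in_image inj); apply: eq_card => s.
apply/idP/fintype.imageP => [/andP[/= s2 si]|[j ji ->]].
  have /cards1P[j sj] : #|(s :\ i)%SET| == 1%N.
    by have := cardsD1 i s; rewrite si (eqP s2); case: #|_| => [|[]].
  exists j; first by have := set11 j; rewrite -sj !inE => /andP[].
  by rewrite -(finset.setD1K si) sj.
have {}ji : j != i by rewrite inE in ji.
by rewrite inE cards2 (eq_sym i j) ji !inE eqxx.
Qed.

(** Double counting: each product lies in [N.-1] pairs, so a fair member of a uniform pair is a
    uniform product. *)
Lemma mean_pairs (g : 'I_N -> R) :
  'C(N, 2)%:R^-1 * (\sum_(s : {set 'I_N} | #|s| == 2%N) (\sum_(i in s) g i) / 2) =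
  N%:R^-1 * \sum_i g i.
Proof.
rewrite -mulr_suml.
under eq_bigr do rewrite big_mkcond/=.
rewrite exchange_big/=.
rewrite (eq_bigr (fun i => g i *+ N.-1)) => [|i _]; last first.
  by rewrite -big_mkcondr/= sumr_const card_pairs_containing.
rewrite sumrMnl -[_ *+ N.-1]mulr_natl.
have -> : N%:R^-1 = N.-1%:R / 'C(N, 2)%:R / 2 :> R.
  have /(congr1 (GRing.natmul (1 : R))) : ('C(N, 2) * 2 = N * N.-1)%N.
    by rewrite mulnC -mul_bin_diag bin1.
  rewrite !natrM => CN; apply: (mulfI N_neq0); rewrite divff//.
  have -> : N%:R * (N.-1%:R / 'C(N, 2)%:R / 2) = (N%:R * N.-1%:R) / 'C(N, 2)%:R / 2 :> R.
    by ring.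
  by rewrite -CN; field.
by ring.
Qed.

(* The pair [{i, j}] alone already gains half of [g i - g j] over a fair choice
   between its two members. *)
Lemma mean_allocate z (g : 'I_N -> R) (i j : 'I_N) :
  (forall k l, (z k <= z l)%N -> g l <= g k) ->
  'C(N, 2)%:R^-1 *
    (\sum_(s : {set 'I_N} | #|s| == 2%N) oapp g 0 (allocate z s)) <=
  N%:R^-1 * (\sum_i g i) - (g i - g j) / (2 * 'C(N, 2)%:R).
Proof.
move=> anti_g.
have alloc_le s : #|s| == 2%N ->
    exists k, [/\ allocate z s = Some k, k \in s & forall l, l \in s -> g k <= g l].
  move=> s2; have /allocateP -/(_ z)[k [sk ks kmax]] : s != finset.set0.
    by rewrite -card_gt0 (eqP s2).
  by exists k; split=> // l ls; apply: anti_g; exact: kmax.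
have half s : #|s| == 2%N -> oapp g 0 (allocate z s) <= (\sum_(i in s) g i) / 2.
  move=> s2; have [k [-> ks kmin]] := alloc_le _ s2; rewrite /= ler_pdivlMr//.
  apply: (@le_trans _ _ (\sum_(i in s) g k)).
    by rewrite sumr_const (eqP s2) mulr_natr.
  exact: ler_sum.
have C_gt0 := bin2_gt0.
(* If [g i <= g j], the subtracted term is nonpositive and the comparison with fair choices
   suffices. *)
have [gij|gij] := leP (g i) (g j).
  apply: (@le_trans _ _ (N%:R^-1 * \sum_i g i)); last first.
    by rewrite lerDl oppr_ge0 mulr_le0_ge0 ?subr_le0// invr_ge0 mulr_ge0// ltW.
  rewrite -mean_pairs ler_wpM2l ?invr_ge0 ?(ltW C_gt0)//.
  exact: ler_sum.
have ij : i != j by apply: contraTneq gij => ->; rewrite ltxx.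
rewrite -mean_pairs.
rewrite [X in _ <= _ * X - _](bigD1 [set i; j]%SET) ?cards2 ?ij//=.
rewrite [X in _ * X <= _](bigD1 [set i; j]%SET) ?cards2 ?ij//=.
have sij : \sum_(k in [set i; j]%SET) g k = g i + g j.
  by rewrite (big_setD1 i) ?set21//= setU1K ?big_set1// !inE.
rewrite sij.
have aij : oapp g 0 (allocate z [set i; j]%SET) <= g j.
  have [|k [-> _]] := alloc_le [set i; j]%SET; first by rewrite cards2 ij.
  by apply; rewrite set22.
set u := \sum_(_ | _) _; set v := (X in _ <= _ * (_ + X) - _).
have uv : u <= v by apply: ler_sum => s /andP[s2 _]; exact: half.
rewrite [_ <= _ - _](_ : _ = ('C(N, 2)%:R^-1 * (oapp g 0 (allocate z [set i; j]%SET) + u) <=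
   'C(N, 2)%:R^-1 * (g j + v))); last by congr (_ <= _); field.
by rewrite ler_wpM2l ?invr_ge0 ?(ltW C_gt0)// lerD.
Qed.

End Events.

(** * Inventory histories and expected rewards of a cycle *)

Section Histories.
Variables (R : realType) (N S : nat) (pol : policy N).
Implicit Types (zs : history N) (e : event N).

Definition stock zs : inventory N := stock_after S zs (size zs).

Definition advance zs e : history N :=
  rcons zs [ffun i => (stock zs i - (sold (pol zs) (stock zs) e == Some i))%N].

(** Conservation law: exactly one unit leaves in each period. *)
Definition balanced zs : Prop := (\sum_i stock zs i + size zs = N * S)%N.

Definition alive zs : Prop := balanced zs /\ ~~ stockout (stock zs).

Definition load zs (i : 'I_N) : R :=
  S%:R - (size zs)%:R / N%:R - (stock zs i)%:R.

Lemma stock_rcons zs z : stock (rcons zs z) = z.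
Proof. by rewrite /stock /stock_after size_rcons /= nth_rcons ltnn eqxx. Qed.

Lemma size_advance zs e : size (advance zs e) = (size zs).+1.
Proof. exact: size_rcons. Qed.

Lemma alive_stock_gt0 zs i : alive zs -> (0 < stock zs i)%N.
Proof. by move=> [_ /existsPn/(_ i)]; rewrite lt0n. Qed.

Lemma alive_nil : (0 < S)%N -> alive [::].
Proof.
move=> S0; split; last by apply/existsPn => i; rewrite ffunE -lt0n.
by rewrite /balanced addn0 (eq_bigr (fun=> S)) ?sum_nat_const ?card_ord// => i _; rewrite ffunE.
Qed.

Lemma balanced_advance zs e : alive zs -> valid e -> balanced (advance zs e).
Proof.
move=> al ve; have [bal _] := al.
rewrite /balanced size_advance stock_rcons -bal.
have [j ->] := sold_valid (pol zs) (stock zs) ve.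
under eq_bigr do rewrite ffunE.
rewrite (bigD1 j)//= [in RHS](bigD1 j)//= eqxx.
under eq_bigr => i ij.
  rewrite (_ : (Some j == Some i) = false) ?subn0; last by apply: contra_neqF ij => /eqP[].
  over.
by have := alive_stock_gt0 j al; lia.
Qed.

Lemma load_advance zs e i j : alive zs ->
  sold (pol zs) (stock zs) e = Some j ->
  load (advance zs e) i = load zs i - N%:R^-1 + (i == j)%:R.
Proof.
move=> al sj; rewrite /load size_advance stock_rcons ffunE sj natrB; last first.
  by rewrite (leq_trans (leq_b1 _))// alive_stock_gt0.
rewrite (_ : (Some j == Some i) = (i == j)) 1?eq_sym//.
by rewrite -(natr1 (size zs)); ring.
Qed.

(** While every product keeps at least one unit, at most [N * (S - 1)] units have been sold. *)
Lemma size_alive zs : (0 < S)%N -> alive zs -> (size zs < horizon N S)%N.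
Proof.
move=> S0 al; have [bal _] := al; rewrite /horizon.
have : (\sum_(i < N) 1 <= \sum_i stock zs i)%N.
  by apply: leq_sum => i _; exact: alive_stock_gt0.
rewrite sum1_card card_ord.
by move: bal; rewrite /balanced mulnBr muln1; nia.
Qed.

Hypothesis N_gt0 : (0 < N)%N.

Let N_neq0 : N%:R != 0 :> R. Proof. by rewrite pnatr_eq0 -lt0n. Qed.

Lemma sum_load zs : balanced zs -> \sum_i load zs i = 0.
Proof.
rewrite /balanced => /(congr1 (GRing.natmul (1 : R))); rewrite natrD natrM.
rewrite /load sumrB sumr_const card_ord natr_sum -[(_ - _) *+ N]mulr_natl.
by move=> H; rewrite mulrBr -H mulrCA divff//; ring.
Qed.

Lemma exists_load_le0 zs : balanced zs -> exists i, load zs i <= 0.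
Proof.
move=> bal; apply/not_existsP => pos.
have : 0 < \sum_i load zs i.
  have i0 : 'I_N := Ordinal N_gt0.
  rewrite (bigD1 i0)//= ltr_pwDl//; first by rewrite real_ltNge ?num_real//; apply/negP/pos.
  by apply: sumr_ge0 => i _; rewrite leNgt; apply/negP => /ltW/pos.
by rewrite sum_load// ltxx.
Qed.

Lemma load_le_gap zs i : load zs i <= gap R S (size zs) (stock zs).
Proof.
rewrite /load /gap lerD2l lerN2 ler_nat.
elim: (index_enum _) (mem_index_enum i) => // j r IH.
rewrite inE big_cons => /orP[/eqP<-|/IH]; first exact: geq_minl.
by move=> h; rewrite geq_min h orbT.
Qed.

(** The first alternative covers the default [S] of the iterated minimum, where the gap is minus the
    elapsed time over [N]. *)
Lemma gap_attained zs : gap R S (size zs) (stock zs) <= 0 \/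
  exists i, gap R S (size zs) (stock zs) = load zs i.
Proof.
rewrite /gap; suff [->|[i ->]] : (\big[minn/S]_(i < N) stock zs i = S)%N \/
    exists i, \big[minn/S]_(i < N) stock zs i = stock zs i.
- by left; rewrite addrAC subrr add0r oppr_le0 divr_ge0.
- by right; exists i.
apply: (big_ind (fun m => m = S \/ exists i, m = stock zs i)); [by left| |by move=> i _; right; exists i].
by move=> m n mP nP; rewrite /minn; case: ifP.
Qed.

Definition opaque_sale zs e : R := (pol zs && e.1.1)%:R.

Lemma opaque_sale_bound zs e : 0 <= opaque_sale zs e <= 1.
Proof. by rewrite /opaque_sale ler0n lern1 leq_b1. Qed.

Section Value.
Variables (q : R) (r : history N -> event N -> R).

(** Pathwise counterpart of the expected reward below; nothing is collected after the stock-out. *)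
Fixpoint gain zs (es : seq (event N)) : R :=
  if es is e :: es' then
    r zs e + (if stockout (stock (advance zs e)) then 0 else gain (advance zs e) es')
  else 0.

(* The expected reward collected from [zs] to the end of the cycle, or over [k]
   periods if the cycle lasts longer. *)
Fixpoint value (k : nat) zs : R :=
  if k is m.+1 then
    avg (weight q) (fun e => r zs e +
      (if stockout (stock (advance zs e)) then 0 else value m (advance zs e)))
  else 0.

Lemma avg_seq_gain k zs :
  0 <= q -> q <= 1 -> (2 <= N)%N ->
  avg_seq (weight q) k (gain zs) = value k zs.
Proof.
move=> q0 q1 N2; have w1 := weight_sum1 q0 q1 N2.
elim: k zs => [//|k IH] zs /=; congr avg; apply/funext => e.
rewrite avg_seqD avg_seq_cst//; congr (_ + _).
by case: ifP => _; rewrite ?avg_seq_cst.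
Qed.

Lemma value_bound B k zs :
  0 <= q -> q <= 1 -> (2 <= N)%N -> (forall zs e, `|r zs e| <= B) ->
  `|value k zs| <= k%:R * B.
Proof.
move=> q0 q1 N2 rB; have w1 := weight_sum1 q0 q1 N2; have w0 := weight_ge0 q0 q1.
elim: k zs => [|k IH] zs /=; first by rewrite normr0 mul0r.
have B0 : 0 <= B.
  have e0 : event N := (true, None, finset.set0).
  exact: le_trans (rB [::] e0).
rewrite ler_norml; apply/andP; split; [apply: avg_ge_cst|apply: avg_le_cst] => // e _;
  move: (rB zs e) (IH (advance zs e)); rewrite !ler_norml -natr1 mulrDl mul1r;
  have kB : 0 <= k%:R * B by [rewrite mulr_ge0];
  by move=> /andP[? ?] /andP[? ?]; case: ifP => _; lra.
Qed.

Lemma value_ge0 k zs :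
  0 <= q -> q <= 1 -> (2 <= N)%N -> (forall zs e, 0 <= r zs e) ->
  0 <= value k zs.
Proof.
move=> q0 q1 N2 r0; elim: k zs => [//|k IH] zs /=.
apply: avg_ge_cst => [e||e _]; first exact: weight_ge0.
  exact: weight_sum1.
by rewrite addr_ge0//; case: ifP.
Qed.

End Value.

(** Serves to recentre the opaque sales by a multiple of the cycle length. *)
Lemma value_comb q r1 r2 a k zs :
  value q (fun zs e => r1 zs e - a * r2 zs e) k zs =
  value q r1 k zs - a * value q r2 k zs.
Proof.
elim: k zs => [|k IH] zs /=; first by rewrite mulr0 subr0.
rewrite -avgZ -avgB; congr avg; apply/funext => e; rewrite IH.
by case: ifP => _; ring.
Qed.

End Histories.

(** * The semi-dynamic policy *)

(** From [(1 - x) * expR x <= 1], the left side is at most [x / (1 - x)], and the bound [x <= 1 / 2]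
    does the rest. *)
Lemma expR_sub1_le (R : realType) (x : R) :
  0 <= x -> x <= 1 / 2 -> expR x - 1 <= x + 2 * x ^+ 2.
Proof.
move=> x0 x1.
have : (1 - x) * expR x <= 1.
  rewrite -[leRHS](expRxMexpNx_1 x) mulrC ler_wpM2l ?expR_ge0//.
  exact: expR_ge1Dx.
have := expR_gt0 x.
by move=> e0 h; nra.
Qed.

Section SemiDynamic.
Variables (R : realType) (N S : nat) (q c : R).
Hypotheses (N_ge2 : (2 <= N)%N) (S_gt0 : (0 < S)%N).
Hypotheses (q_gt0 : 0 < q) (q_le1 : q <= 1).
Hypotheses (c_gt0 : 0 < c) (c_le : c <= 1 / (10 * 'C(N, 2)%:R)).
Implicit Types (zs : history N) (e : event N).

Let pol : policy N := semi_dynamic q c S.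
Let T := horizon N S.
Let N_gt0 : (0 < N)%N. Proof. by lia. Qed.
Let Nr_gt0 : 0 < N%:R :> R. Proof. by rewrite ltr0n. Qed.
Let C_ge1 : 1 <= 'C(N, 2)%:R :> R. Proof. by rewrite ler1n bin_gt0. Qed.
Let C_neq0 : 'C(N, 2)%:R != 0 :> R.
Proof. by rewrite lt0r_neq0// (lt_le_trans ltr01). Qed.
Let N_neq0 : N%:R != 0 :> R. Proof. exact: lt0r_neq0. Qed.
Let q_ge0 : 0 <= q := ltW q_gt0.
Let w_ge0 := weight_ge0 q_ge0 q_le1 : forall e : event N, 0 <= weight q e.
Let w_sum1 := weight_sum1 q_ge0 q_le1 N_ge2.

(** The starting condition at the current period alone; the policy is its disjunction over all
    periods so far, so an offer persists. *)
Definition trigger zs : bool :=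
  c * (T%:R - (size zs)%:R) * q / N%:R <= gap R S (size zs) (stock S zs).

Lemma offered_rcons zs z : pol (rcons zs z) = pol zs || trigger (rcons zs z).
Proof.
have stockE t : (t <= size zs)%N ->
    stock_after S (rcons zs z) t = stock_after S zs t.
  by case: t => [//|t] ts; rewrite /stock_after /= nth_rcons ts.
apply/idP/orP => [/existsP[[t /= tP] trig]|[/existsP[[t /= tP] trig]|trig]].
- move: tP; rewrite ltnS size_rcons leq_eqVlt => /orP[/eqP tE|].
    by right; rewrite /trigger /stock size_rcons -tE.
  rewrite ltnS => ts; left; apply/existsP.
  by exists (Ordinal (ts : (t < (size zs).+1)%N)); rewrite /= -stockE.
- apply/existsP; rewrite size_rcons.
  have tP' : (t < (size zs).+2)%N := leqW tP.
  by exists (Ordinal tP'); rewrite /= stockE// -ltnS.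
- by apply/existsP; exists ord_max.
Qed.

Lemma notoffered_gap zs : ~~ pol zs ->
  gap R S (size zs) (stock S zs) < c * (T%:R - (size zs)%:R) * q / N%:R.
Proof. by move=> /existsPn/(_ ord_max); rewrite -ltNge. Qed.

(** At the start of a cycle the gap is at most 0, whereas the threshold is positive because the
    horizon is at least 1. *)
Lemma notoffered_nil : ~~ pol [::].
Proof.
apply/existsPn => -[[|//] /= _]; rewrite -ltNge; apply: (@le_lt_trans _ _ 0).
  have [//|[i /=]] := @gap_attained R N S [::].
  by rewrite /load /gap /stock /= ffunE => ->; rewrite mul0r subr0 subrr.
by rewrite divr_gt0// mulr_gt0// mulr_gt0// subr0 ltr0n /T /horizon addn1.
Qed.

(* [eps] is small enough for the second-order terms of the exponential potential
   to be dominated by its drift, and [a <= eps] is where the bound on [c] enters: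
   it makes the discount [rho] weaker than the contraction. *)
Let a := c * q.
Let b := q / (2 * 'C(N, 2)%:R).
Let eps := b / 5.
Let rho := expR (- (eps * a / N%:R)).

Let b_gt0 : 0 < b.
Proof. by rewrite divr_gt0// mulr_gt0// (lt_le_trans ltr01). Qed.

Let b_le : b <= 1 / 2.
Proof.
rewrite /b; have := q_le1; move: C_ge1; move: ('C(N, 2)%:R : R) => C C1 q1.
by rewrite ler_pdivrMr; lra.
Qed.

Let a_gt0 : 0 < a. Proof. exact: mulr_gt0. Qed.

(** The 10 in the bound on [c] is the 2 in [b] times the 5 in [eps]. *)
Let a_le : a <= eps.
Proof.
rewrite /a /eps /b (_ : q / _ / 5 = 1 / (10 * 'C(N, 2)%:R) * q); last by field.
by rewrite ler_wpM2r.
Qed.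

Let eps_gt0 : 0 < eps. Proof. by rewrite divr_gt0. Qed.
Let eps_le : eps <= 1 / 10. Proof. by rewrite /eps; have := b_le; lra. Qed.

Let rho_gt0 : 0 < rho. Proof. exact: expR_gt0. Qed.

Let rho_lt1 : rho < 1.
Proof. by rewrite /rho -[ltRHS]expR0 ltr_expR oppr_lt0 divr_gt0// mulr_gt0. Qed.

(** * Exponential potential and the mean length of a cycle *)

Definition potential zs : R := \sum_i expR (eps * load R S zs i).

(** Every load drops by [1 / N], which gives the common factor; only the sold product also gains
    [expR eps]. *)
Lemma potential_advance zs e j : alive S zs ->
  sold (pol zs) (stock S zs) e = Some j ->
  potential (advance S pol zs e) = expR (- (eps / N%:R)) *
    (potential zs + (expR eps - 1) * expR (eps * load R S zs j)).
Proof.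
move=> al sj; rewrite /potential (bigD1 j)//= [in RHS](bigD1 j)//=.
rewrite (load_advance R j al sj) eqxx [X in _ + X = _](eq_bigr
  (fun i => expR (- (eps / N%:R)) * expR (eps * load R S zs i))) => [|i ij].
  rewrite -mulr_sumr (_ : eps * (_ - _ + _) =
    - (eps / N%:R) + eps + eps * load R S zs j); last by rewrite mulr1n; field.
  by rewrite !expRD; ring.
by rewrite (load_advance R i al sj) (negbTE ij) -expRD; congr expR; rewrite mulr0n; field.
Qed.

(** [mean_allocate] is applied to the terms of the potential. The largest term is at least their
    average and a term of nonpositive load is at most 1; this difference produces the factor [1 - b]
    and the additive [b]. *)
Lemma avg_potential_advance zs : alive S zs -> pol zs ->
  avg (weight q) (fun e => potential (advance S pol zs e)) <=
  expR (- (eps / N%:R)) * (potential zs +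
    (expR eps - 1) * (potential zs / N%:R * (1 - b) + b)).
Proof.
move=> al pz; have [bal _] := al.
set g := fun i => expR (eps * load R S zs i).
rewrite (eq_avg w_ge0 (g := fun e => expR (- (eps / N%:R)) * potential zs +
   expR (- (eps / N%:R)) * (expR eps - 1) * oapp g 0 (sold (pol zs) (stock S zs) e))).
  rewrite avgD avg_cst// avgZ avg_sold// pz [leRHS]mulrDr -mulrA lerD2l.
  rewrite ler_wpM2l ?expR_ge0//.
  have e0 : 0 <= expR eps - 1 by rewrite subr_ge0 -[leLHS]expR0 ler_expR ltW.
  rewrite ler_wpM2l//.
  have i0 : 'I_N := Ordinal N_gt0.
  have [i _ imax] := @arg_maxP _ _ _ i0 xpredT g isT.
  have [j jle0] := exists_load_le0 R N_gt0 bal.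
  have anti k l : (stock S zs k <= stock S zs l)%N -> g l <= g k.
    move=> kl; rewrite /g ler_expR ler_wpM2l ?(ltW eps_gt0)// /load.
    by rewrite lerD2l lerN2 ler_nat.
  have := mean_allocate q_ge0 q_le1 N_ge2 i j anti.
  rewrite -/(potential zs).
  set m := _^-1 * \sum_(s | _) _ => mP.
  have gj : g j <= 1 by rewrite /g -[leRHS]expR0 ler_expR pmulr_rle0.
  have gi : potential zs / N%:R <= g i.
    rewrite ler_pdivrMr//.
    rewrite (_ : g i * N%:R = \sum_(k < N) g i); last by rewrite sumr_const card_ord mulr_natr.
    by rewrite /potential; apply: ler_sum => k _; exact: imax.
  have -> : potential zs / N%:R * (1 - b) + b = q * (N%:R^-1 * potential zs -
      (potential zs / N%:R - 1) / (2 * 'C(N, 2)%:R)) + (1 - q) * (N%:R^-1 * potential zs).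
    by rewrite /b; field; rewrite C_neq0 N_neq0.
  rewrite lerD2r ler_wpM2l// (le_trans mP)// lerD2l lerN2 ler_wpM2r//; last by lra.
move=> e /weight_valid /(sold_valid (pol zs) (stock S zs))[j sj].
by rewrite (potential_advance al sj) sj /= mulrDr mulrA.
Qed.

(** After [1 + x <= expR x], the factor of the potential is at most [rho] as soon as [(expR eps - 1)
    * (1 - b) <= eps * (1 - a)]; the additive term is at most 1. *)
Lemma avg_potential_drift k zs : alive S zs -> pol zs ->
  avg (weight q) (fun e => rho ^+ k * potential (advance S pol zs e)) <=
  rho ^+ k.+1 * potential zs + rho ^+ k.
Proof.
move=> al pz; rewrite avgZ exprSr -mulrA -[X in _ + X]mulr1 -mulrDr.
rewrite ler_wpM2l ?exprn_ge0 ?(ltW rho_gt0)//.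
apply: (le_trans (avg_potential_advance al pz)).
have e1 := expR_sub1_le (ltW eps_gt0) (le_trans eps_le (_ : 1 / 10 <= 1 / 2)).
have {}e1 : expR eps - 1 <= eps + 2 * eps ^+ 2 by apply: e1; lra.
have e0 : 0 <= expR eps - 1 by rewrite subr_ge0 -[leLHS]expR0 ler_expR ltW.
have u0 := expR_ge0 (- (eps / N%:R)).
have u1 : expR (- (eps / N%:R)) <= 1.
  by rewrite -[leRHS]expR0 ler_expR oppr_le0 divr_ge0// ltW.
have Phi0 : 0 <= potential zs by apply: sumr_ge0 => i _; exact: expR_ge0.
rewrite (_ : expR _ * _ = expR (- (eps / N%:R)) *
   (1 + (expR eps - 1) * (1 - b) / N%:R) * potential zs +
   expR (- (eps / N%:R)) * ((expR eps - 1) * b)); last by field.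
apply: lerD.
  rewrite ler_wpM2r// (le_trans (ler_wpM2l u0 (expR_ge1Dx _)))// -expRD.
  rewrite ler_expR addrC -[X in _ + X]mulNr -[leRHS]mulNr -mulrDl ler_pM2r ?invr_gt0//.
  have : (expR eps - 1) * (1 - b) <= (eps + 2 * eps ^+ 2) * (1 - b).
    by rewrite ler_wpM2r//; have := b_le; lra.
  (* With [b = 5 * eps] the left side is [eps * (1 - 3 * eps - 10 * eps ^+ 2)]. *)
  have : (eps + 2 * eps ^+ 2) * (1 - b) <= eps * (1 - eps).
    by rewrite (_ : b = 5 * eps) ?/eps; [have := b_le; have := b_gt0; nra|field].
  have : eps * a <= eps * eps by rewrite ler_wpM2l ?(ltW eps_gt0).
  move=> h1 h2 h3.
  lra.
rewrite -[leRHS]mul1r ler_pM ?mulr_ge0 ?(ltW b_gt0)//.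
rewrite -[leRHS]mul1r ler_pM ?(ltW b_gt0)//; last by have := b_le; lra.
by have := eps_gt0; have := eps_le; nra.
Qed.

Lemma offered_advance zs e : pol zs -> pol (advance S pol zs e).
Proof. by move=> pz; rewrite offered_rcons pz. Qed.

(* Before the opaque product is offered the gap stays below the threshold, so
   every load is at most the threshold plus one after one more sale. *)
Lemma potential_notoffered k zs e : alive S zs -> ~~ pol zs -> valid e ->
  (k.+1 + size zs = T)%N ->
  rho ^+ k * potential (advance S pol zs e) <= N%:R * expR 2.
Proof.
move=> al npz ve kT.
have [j sj] := sold_valid (pol zs) (stock S zs) ve.
have gap_lt := notoffered_gap npz.
rewrite -kT natrD addrK in gap_lt.
rewrite /rho -expRM_natr mulr_sumr.
rewrite (_ : N%:R * expR 2 = \sum_(i < N) expR 2); last first.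
  by rewrite sumr_const card_ord mulr_natl.
apply: ler_sum => i _; rewrite -expRD ler_expR.
have := load_le_gap R S zs i; rewrite (load_advance R i al sj) => li.
have {}li : load R S zs i - N%:R^-1 + (i == j)%:R <= a * k.+1%:R / N%:R + 1.
  apply: lerD; last by case: eqP.
  rewrite (le_trans _ (le_trans li _))//; first by rewrite gerBl invr_ge0.
  by rewrite (le_trans (ltW gap_lt))// /a le_eqVlt; apply/orP; left; apply/eqP; ring.
apply: (@le_trans _ _ (- (eps * a / N%:R) * k%:R + eps * (a * k.+1%:R / N%:R + 1))).
  by rewrite lerD2l ler_wpM2l// ltW.
rewrite -(natr1 k) (_ : - (eps * a / N%:R) * k%:R + _ = eps * (a / N%:R + 1)); last first.
  by field.
have aN : a / N%:R <= 1.
  rewrite ler_pdivrMr// mul1r.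
  have : 1 <= N%:R :> R by rewrite ler1n.
  by have := a_le; have := eps_le; lra.
have a0 : 0 <= a / N%:R by rewrite divr_ge0// ltW.
by have := eps_le; have := eps_gt0; nra.
Qed.

(** The empty product has load at least [k / N], because [k + size zs <= N * S]. Its term alone,
    discounted by [rho ^+ k], is at least [expR (eps * (1 - a) * k / N)], which dominates its
    exponent. *)
Lemma potential_stockout k zs : balanced S zs -> stockout (stock S zs) ->
  (k + size zs = T)%N ->
  k%:R <= N%:R / (eps * (1 - a)) * (rho ^+ k * potential zs).
Proof.
move=> bal /existsP[i /eqP zi] kT.
have a1 : 0 < 1 - a by have := a_le; have := eps_le; lra.
have lE : k%:R / N%:R <= load R S zs i.
  rewrite /load zi subr0 ler_pdivrMr// mulrBl divfK//.
  rewrite -natrM lerBrDr -natrD ler_nat kT /T /horizon mulnBr muln1.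
  by rewrite addn1 (mulnC S) ltn_subrL N_gt0 muln_gt0 N_gt0.
rewrite mulrAC (ler_pdivlMr _ _ (mulr_gt0 eps_gt0 a1)) mulrC -ler_pdivrMl// mulrA.
have : expR (eps * (1 - a) * k%:R / N%:R) <= rho ^+ k * potential zs.
  rewrite /rho -expRM_natr /potential (bigD1 i)//= [leRHS]mulrDr -expRD -[leLHS]addr0 lerD//.
    rewrite ler_expR.
    have := ler_wpM2l (ltW eps_gt0) lE.
    rewrite (_ : eps * (1 - a) * k%:R / N%:R =
       eps * (k%:R / N%:R) - eps * a / N%:R * k%:R); last by field.
    lra.
  by rewrite mulr_ge0 ?expR_ge0// sumr_ge0// => l _; exact: expR_ge0.
apply: le_trans; apply: le_trans (expR_ge1Dx _).
rewrite (_ : eps * (1 - a) * k%:R / N%:R = N%:R^-1 * (eps * (1 - a)) * k%:R); last by field.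
by rewrite lerDr.
Qed.

(** Partial geometric sum: the additive errors of the drift accumulated over the last [k]
    periods. *)
Let geom k : R := (1 - rho ^+ k) / (1 - rho).

Let geomS k : geom k.+1 = geom k + rho ^+ k.
Proof.
rewrite /geom exprSr; field.
by rewrite subr_eq0 eq_sym lt_eqF.
Qed.

Let geom_le k : geom k <= 1 / (1 - rho).
Proof.
rewrite ler_pM2r ?invr_gt0 ?subr_gt0//.
by rewrite gerBl exprn_ge0// ltW.
Qed.

(** The bound on the discounted potential when the offer starts, plus all later errors. It is
    independent of [S], whence the bounded [theta]. *)
Definition shortfall : R :=
  N%:R / (eps * (1 - a)) * (N%:R * expR 2 + 1 / (1 - rho)).

(** The left side is the mean number of periods left at the stock-out. Once the product is offered,
    the discounted potential plus [geom] is a supermartingale that dominates it at the stock-out. *)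
Lemma cycle_shortfall k zs : alive S zs -> (k + size zs = T)%N ->
  k%:R - value S pol q (fun _ _ => 1) k zs <=
  if pol zs then N%:R / (eps * (1 - a)) * (rho ^+ k * potential zs + geom k)
  else shortfall.
Proof.
have a1 : 0 < 1 - a by have := a_le; have := eps_le; lra.
have Q0 : 0 <= N%:R / (eps * (1 - a)).
  by rewrite divr_ge0 ?ler0n// ltW// (mulr_gt0 eps_gt0 a1).
elim: k zs => [|k IH] zs al kT.
  (* The case [k = 0] is vacuous: an alive history is shorter than the horizon. *)
  by have := size_alive S_gt0 al; rewrite -/T -kT add0n ltnn.
set Q := N%:R / _ in IH Q0 *.
set rest := fun e => k%:R - (if stockout (stock S (advance S pol zs e)) then 0
                  else value S pol q (fun _ _ => 1) k (advance S pol zs e)).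
have -> : k.+1%:R - value S pol q (fun _ _ => 1) k.+1 zs = avg (weight q) rest.
  by rewrite /= avgD avg_cst// avgB avg_cst// -natr1; ring.
have kT' e : (k + size (advance S pol zs e) = T)%N by rewrite size_advance addnS -addSn.
have step e : valid e -> rest e <= Q *
   (if pol (advance S pol zs e) then rho ^+ k * potential (advance S pol zs e) + geom k
    else N%:R * expR 2 + 1 / (1 - rho)) \/
   rest e <= Q * (rho ^+ k * potential (advance S pol zs e)).
  move=> ve; have bal := balanced_advance pol al ve.
  rewrite /rest; case: ifPn => so.
    by right; rewrite subr0; exact: potential_stockout.
  by left; have := IH _ (conj bal so) (kT' e); case: ifP.
have g0 : 0 <= geom k.
  rewrite divr_ge0// subr_ge0 ?(ltW rho_lt1)// exprn_ile1// ltW//.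
case: ifPn => pz.
  apply: (@le_trans _ _ (avg (weight q) (fun e =>
      Q * (rho ^+ k * potential (advance S pol zs e) + geom k)))).
    apply: le_avg => // e /weight_valid ve.
    have [|h] := step _ ve; first by rewrite offered_advance.
    by rewrite (le_trans h)// ler_wpM2l// lerDl.
  rewrite avgZ avgD avg_cst// ler_wpM2l// geomS [geom k + _]addrC addrA lerD2r.
  exact: avg_potential_drift.
(* Not offered yet: the next period brings the stock-out, the start of the offer or neither, and
   [shortfall] covers all three. *)
apply: avg_le_cst => // e /weight_valid ve.
have pe := potential_notoffered al pz ve kT.
rewrite /shortfall -/Q.
have d0 : 0 <= 1 / (1 - rho) by rewrite divr_ge0// subr_ge0 ltW.
have [h|h] := step _ ve; rewrite (le_trans h)// ler_wpM2l//.
  by case: ifP => // _; rewrite lerD// geom_le.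
by rewrite (le_trans pe)// lerDl.
Qed.

Lemma mean_length_ge :
  T%:R - shortfall <= value S pol q (fun _ _ => 1) T [::].
Proof.
have := @cycle_shortfall T [::] (alive_nil N S_gt0) (addn0 _).
by rewrite (negbTE notoffered_nil); lra.
Qed.

(** * Squared loads and the mean number of opaque sales *)

Definition imbalance zs : R := \sum_i load R S zs i ^+ 2.

(** As the loads sum to 0, a sale of [j] adds [2 * load j + 1 - 1 / N]; for a uniform favourite the
    mean of [load j] vanishes. *)
Lemma avg_imbalance zs : alive S zs -> ~~ pol zs ->
  avg (weight q) (fun e => imbalance (advance S pol zs e)) <= imbalance zs + 1.
Proof.
move=> al pz; have [bal _] := al.
have sum0 := sum_load R N_gt0 bal.
rewrite (eq_avg w_ge0 (g := fun e => (imbalance zs + 1 - N%:R^-1) +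
   2 * oapp (load R S zs) 0 (sold (pol zs) (stock S zs) e))).
  rewrite avgD avg_cst// avgZ avg_sold// (negbTE pz) sum0 !mulr0 addr0.
  by rewrite gerBl invr_ge0.
move=> e /weight_valid /(sold_valid (pol zs) (stock S zs))[j sj].
rewrite sj /= /imbalance.
under eq_bigr do rewrite (load_advance R _ al sj).
rewrite (bigD1 j)//= eqxx.
under eq_bigr => i ij do rewrite (negbTE ij) addr0 sqrrB.
rewrite big_split/= sumrB sumrMnl -mulr_suml.
rewrite [in RHS](bigD1 j)//=.
move: sum0; rewrite (bigD1 j)//= => /eqP; rewrite addrC addr_eq0 => /eqP ->.
rewrite (eq_bigl (fun i => i \in predC1 j))// sumr_const cardC1 card_ord -[_ *+ N.-1]mulr_natr.
have -> : N.-1%:R = N%:R - 1 :> R by rewrite -[in RHS](prednK N_gt0) -natr1 addrK.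
by rewrite mulr1n mulr2n; field.
Qed.

(** Completing the square gives a bound affine in the imbalance, which passes through means, unlike
    a square root; [lam] is chosen later. *)
Lemma gap_le_imbalance zs lam : 0 < lam ->
  gap R S (size zs) (stock S zs) <= lam * imbalance zs + 1 / (4 * lam).
Proof.
move=> l0; have imb0 : 0 <= imbalance zs by apply: sumr_ge0 => i _; exact: sqr_ge0.
have [g0|[i ->]] := gap_attained R S zs.
  by rewrite (le_trans g0)// addr_ge0 ?divr_ge0 ?mulr_ge0// ltW.
apply: (@le_trans _ _ (lam * load R S zs i ^+ 2 + 1 / (4 * lam))).
  rewrite -subr_ge0.
  rewrite (_ : _ - _ = lam * (load R S zs i - 1 / (2 * lam)) ^+ 2).
    by rewrite mulr_ge0 ?sqr_ge0// ltW.
  by field; rewrite lt0r_neq0.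
rewrite lerD2r ler_wpM2l ?(ltW l0)// /imbalance (bigD1 i)//= lerDl.
by apply: sumr_ge0 => k _; exact: sqr_ge0.
Qed.

(** Sales are at most the periods left when the offer starts, which the trigger bounds through the
    gap; until then, imbalance plus periods left is a supermartingale. *)
Lemma opaque_sales_le lam k zs : 0 < lam -> alive S zs -> (k + size zs = T)%N ->
  value S pol q (opaque_sale R pol) k zs <=
  if pol zs then k%:R
  else N%:R / a * (lam * (imbalance zs + k%:R) + 1 / (4 * lam)).
Proof.
move=> l0; have Na0 : 0 <= N%:R / a by rewrite divr_ge0// ltW.
have imb0 zs' : 0 <= imbalance zs' by apply: sumr_ge0 => i _; exact: sqr_ge0.
have le_k k' zs' : value S pol q (opaque_sale R pol) k' zs' <= k'%:R.
  apply: le_trans (ler_norm _) _; rewrite -[leRHS]mulr1; apply: value_bound => //.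
  by move=> zs'' e; have /andP[? ?] := opaque_sale_bound R pol zs'' e; rewrite ger0_norm.
elim: k zs => [|k IH] zs al kT.
  by have := size_alive S_gt0 al; rewrite -/T -kT add0n ltnn.
case: ifPn => pz; first exact: le_k.
have B0 x : 0 <= x -> 0 <= N%:R / a * (lam * x + 1 / (4 * lam)).
  by move=> x0; rewrite mulr_ge0 ?addr_ge0 ?divr_ge0 ?mulr_ge0// ltW.
apply: (@le_trans _ _ (avg (weight q) (fun e => N%:R / a * (lam * k%:R + 1 / (4 * lam)) +
    N%:R / a * lam * imbalance (advance S pol zs e)))); last first.
  rewrite avgD avg_cst// avgZ.
  have := ler_wpM2l (mulr_ge0 Na0 (ltW l0)) (avg_imbalance al pz).
  by rewrite -natr1; lra.
apply: le_avg => // e /weight_valid ve.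
rewrite {1}/opaque_sale (negbTE pz) add0r.
set zs' := advance S pol zs e.
rewrite (_ : _ + _ = N%:R / a * (lam * (imbalance zs' + k%:R) + 1 / (4 * lam))); last by ring.
case: ifPn => so; first by apply: B0; rewrite addr_ge0.
have kT' : (k + size zs' = T)%N by rewrite size_advance addnS -addSn.
have := IH zs' (conj (balanced_advance pol al ve) so) kT'.
case: ifPn => // pz' /le_trans; apply.
(* The offer starts exactly here, so the trigger holds at [zs'] itself. *)
have : trigger zs' by move: pz'; rewrite /zs' /advance offered_rcons (negbTE pz).
rewrite /trigger -kT' natrD addrK => /le_trans/(_ (gap_le_imbalance zs' l0)) h.
rewrite mulrAC ler_pdivlMr// mulrC -ler_pdivrMl//.
rewrite (_ : _ * (a * k%:R) = c * k%:R * q / N%:R); last by rewrite /a; ring.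
rewrite (le_trans h)// lerD2r ler_wpM2l ?(ltW l0)// lerDl//.
Qed.

Lemma mean_opaque_sales_le :
  value S pol q (opaque_sale R pol) T [::] <= N%:R / a * (5 / 4 * Num.sqrt T%:R).
Proof.
have T0 : 0 < T%:R :> R by rewrite ltr0n /T /horizon addn1.
have s0 : 0 < Num.sqrt T%:R :> R by rewrite sqrtr_gt0.
(* This [lam] makes [lam * T] and [1 / (4 * lam)] both of order [sqrt T], with total factor
   [1 + 1 / 4]. *)
have := @opaque_sales_le (Num.sqrt T%:R)^-1 T [::].
rewrite invr_gt0 s0 (negbTE notoffered_nil) => /(_ isT (alive_nil N S_gt0) (addn0 _)).
have -> : imbalance [::] = 0.
  by apply: big1 => i _; rewrite /load /stock /= ffunE mul0r subr0 subrr expr0n.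
move/le_trans; apply; rewrite ler_wpM2l ?divr_ge0 ?ler0n ?(ltW a_gt0)//.
rewrite add0r le_eqVlt; apply/orP; left; apply/eqP.
move: s0 (sqr_sqrtr (ltW T0)); set s := Num.sqrt _ => s0 <-; field.
by rewrite lt0r_neq0.
Qed.

End SemiDynamic.

(** * Sample paths and renewals *)

Section Paths.
Variables (R : realType) (N : nat) (vbar gamma delta : R) (pol : policy N) (S : nat).
Implicit Types (zs : history N) (e : event N).

(** The preference is evaluated as if the product were offered, so the event does not depend on the
    policy. *)
Definition customer_event (x : R) (s : {set 'I_N}) : event N :=
  (buys_opaque N vbar gamma delta true x, favourite N vbar gamma x, s).

Definition event_revenue zs e : R :=
  if pol zs && e.1.1 then price N vbar gamma - delta
  else if e.1.2 is Some _ then price N vbar gamma else 0.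

Fixpoint event_total zs (es : seq (event N)) : R :=
  if es is e :: es' then
    event_revenue zs e + event_total (replenish S (advance S pol zs e)) es'
  else 0.

Section Path.
Variables (x : nat -> R) (pair : nat -> {set 'I_N}).
Let ev k := customer_event (x k) (pair k).
Let cycle t := first_cycle vbar gamma delta pol S x pair t.

Lemma size_first_cycle t : size (cycle t) = t.
Proof. by elim: t => [//|t IH]; rewrite /cycle /= /extend size_rcons -/(cycle t) IH. Qed.

Lemma gain_path r s k L :
  (forall t, (t < L)%N -> ~~ stockout (stock S (cycle t))) ->
  stockout (stock S (cycle L)) -> (s < L)%N -> (L <= s + k)%N ->
  @gain R N S pol r (cycle s) [seq ev t | t <- iota s k] =
  \sum_(s <= t < L) r (cycle t) (ev t).
Proof.
move=> noL soL; elim: k s => [|k IH] s sL Lsk.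
  by rewrite addn0 leqNgt sL in Lsk.
rewrite big_ltn//= -[advance _ _ _ _]/(cycle s.+1); congr (_ + _).
move: sL; rewrite leq_eqVlt => /orP[/eqP sL|sL].
  by rewrite sL soL big_geq.
by rewrite (negbTE (noL _ sL)) IH// addSn -addnS.
Qed.

Lemma cycle_lengthE L :
  (forall t, (t < L)%N -> ~~ stockout (stock S (cycle t))) ->
  stockout (stock S (cycle L)) -> cycle_length vbar gamma delta pol S x pair = L.
Proof.
move=> noL soL; rewrite /cycle_length; case: pselect => [ex|[]]; last by exists L.
case: ex_minnP => m som minm; apply/eqP; rewrite eqn_leq minm//= leqNgt.
by apply/negP => /noL; rewrite /cycle/stock som.
Qed.

(** A positive [m] cannot be the default value of [cycle_length]. *)
Lemma cycle_lengthP m : (0 < m)%N ->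
  cycle_length vbar gamma delta pol S x pair = m <->
  stockout (stock S (cycle m)) /\ forall t, (t < m)%N -> ~~ stockout (stock S (cycle t)).
Proof.
move=> m0; split=> [|[som nom]]; last exact: cycle_lengthE.
rewrite /cycle_length; case: pselect => [ex|_ m0']; last by rewrite -m0' in m0.
case: ex_minnP => k sok kmin <-; split=> // t tk; apply/negP => sot.
by have := kmin t sot; rewrite leqNgt tk.
Qed.

Hypotheses (N_gt0 : (0 < N)%N) (S_gt0 : (0 < S)%N).
Hypothesis ev_valid : forall k, (k < horizon N S)%N -> valid (ev k).

(** Valid events sell one unit each, so a cycle alive up to the horizon would contradict
    [size_alive]. *)
Lemma exists_stockout : exists L,
  [/\ (0 < L)%N, (L <= horizon N S)%N,
      forall t, (t < L)%N -> ~~ stockout (stock S (cycle t)) &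
      stockout (stock S (cycle L))].
Proof.
have al t : (t <= horizon N S)%N ->
    (forall u, (u <= t)%N -> ~~ stockout (stock S (cycle u))) -> alive S (cycle t).
  elim: t => [|t IH] tT no; first exact: alive_nil.
  split; last exact: no.
  apply: (balanced_advance pol (e := ev t)); last exact: ev_valid.
  by apply: IH => [|u ut]; [exact: ltnW|exact/no/leqW].
have [L soL] : exists L, (L <= horizon N S)%N && stockout (stock S (cycle L)).
  apply/not_existsP => noso.
  have : alive S (cycle (horizon N S)).
    by apply: al => // u uT; apply/negP => so; apply: (noso u); rewrite uT.
  by move=> /(size_alive S_gt0); rewrite size_first_cycle ltnn.
case: (ex_minnP (ex_intro (fun L => (L <= _)%N && stockout (stock S (cycle L))) L soL)).
move=> m /andP[mT som] minm; exists m; split=> //.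
  by rewrite lt0n; apply: contraTneq som => ->; have [] := alive_nil N S_gt0.
move=> t tm; apply/negP => so; have := minm t.
by rewrite so (leq_trans (ltnW tm) mT) leqNgt tm => /(_ isT).
Qed.

Lemma gain_cycle r :
  @gain R N S pol r [::] [seq ev t | t <- iota 0 (horizon N S)] =
  \sum_(t < cycle_length vbar gamma delta pol S x pair) r (cycle t) (ev t).
Proof.
have [L [L0 LT noL soL]] := exists_stockout.
by rewrite (@gain_path r 0 _ L)// (cycle_lengthE noL soL) big_mkord.
Qed.

Lemma cycle_length_gain :
  (cycle_length vbar gamma delta pol S x pair)%:R =
  @gain R N S pol (fun _ _ => 1) [::] [seq ev t | t <- iota 0 (horizon N S)].
Proof. by rewrite gain_cycle sumr_const card_ord. Qed.

Lemma opaque_purchases_gain :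
  (opaque_purchases vbar gamma delta pol S x pair)%:R =
  @gain R N S pol (opaque_sale R pol) [::] [seq ev t | t <- iota 0 (horizon N S)].
Proof. by rewrite gain_cycle /opaque_purchases natr_sum. Qed.

End Path.

Lemma eq_first_cycle (x x' : nat -> R) (p p' : nat -> {set 'I_N}) t :
  (forall k, (k < t)%N -> customer_event (x k) (p k) = customer_event (x' k) (p' k)) ->
  first_cycle vbar gamma delta pol S x p t = first_cycle vbar gamma delta pol S x' p' t.
Proof.
elim: t => [//|t IH] eqx /=; rewrite IH => [|k kt]; last exact/eqx/leqW.
by rewrite -![extend _ _ _ _ _ _ _ _]/(advance S pol _ (customer_event _ _)) eqx.
Qed.

Lemma total_revenueE (x : nat -> R) (pair : nat -> {set 'I_N}) n :
  total_revenue vbar gamma delta pol S x pair n =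
  event_total [::] [seq customer_event (x k) (pair k) | k <- iota 0 n].
Proof.
transitivity (\sum_(0 <= k < n) revenue N vbar gamma delta
    (pol (current_cycle vbar gamma delta pol S x pair k)) (x k)).
  by rewrite big_mkord.
rewrite -[[::] in RHS]/(current_cycle vbar gamma delta pol S x pair 0).
rewrite -[in LHS](add0n n); elim: n 0%N => [|n IH] s; first by rewrite addn0 big_geq.
by rewrite addnS big_ltn ?ltnS ?leq_addr// -addSn IH.
Qed.

(** * Renewal reward and the second moment of the cycle length *)

Section Renewal.
Variable q : R.
Hypotheses (q_ge0 : 0 <= q) (q_le1 : q <= 1) (N_ge2 : (2 <= N)%N) (S_gt0 : (0 < S)%N).
Let T := horizon N S.
Let mean_length := value S pol q (fun _ _ => 1) T [::].
Let mean_sales := value S pol q (opaque_sale R pol) T [::].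

Lemma mean_length_ge1 : 1 <= mean_length.
Proof.
rewrite /mean_length /T /horizon addn1 /=; apply: avg_ge_cst => [e||e _].
- exact: weight_ge0.
- exact: weight_sum1.
- by rewrite lerDl; case: ifP => // _; exact: value_ge0.
Qed.

(* The relative value [v] solves the Poisson equation of the chain, because it
   vanishes at the start of a cycle; hence the accumulated revenue stays within
   a constant of its linear trend. *)
Lemma event_total_linear : exists B, forall n,
  `|avg_seq (weight q) n (event_total [::]) -
    n%:R * (price N vbar gamma - delta * (mean_sales / mean_length))| <= B.
Proof.
have w0 (e : event N) := weight_ge0 q_ge0 q_le1 e; have w1 := weight_sum1 q_ge0 q_le1 N_ge2.
(* The renewal-reward ratio: it gives the recentred reward [r] mean 0 over a cycle. *)
set g := mean_sales / mean_length.
pose r zs e : R := opaque_sale R pol zs e - g * 1.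
pose v zs := value S pol q r (T - size zs) zs.
have v0 : v [::] = 0.
  rewrite /v subn0 /r (value_comb S pol q (opaque_sale R pol) (fun _ _ => 1)).
  rewrite -/mean_length -/mean_sales /g mulfVK ?subrr//.
  by rewrite gt_eqF// (lt_le_trans ltr01 mean_length_ge1).
have vB zs : `|v zs| <= T%:R * (1 + `|g|).
  apply: (@le_trans _ _ ((T - size zs)%:R * (1 + `|g|))).
    apply: value_bound => // zs' e; rewrite /r mulr1 (le_trans (ler_normB _ _))// lerD2r.
    by have /andP[? ?] := opaque_sale_bound R pol zs' e; rewrite ger0_norm.
  by rewrite ler_wpM2r ?addr_ge0// ler_nat leq_subr.
exists (`|delta| * (T%:R * (1 + `|g|))) => n.
(* For the induction the claim is extended to all alive histories, with the correction
   [delta * v]. *)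
suff dev zs : alive S zs -> `|avg_seq (weight q) n (event_total zs) -
    n%:R * (price N vbar gamma - delta * g) + delta * v zs| <=
    `|delta| * (T%:R * (1 + `|g|)).
  by have := dev _ (alive_nil N S_gt0); rewrite v0 mulr0 addr0.
elim: n zs => [|n IH] zs al /=.
  by rewrite mul0r subrr add0r normrM ler_wpM2l.
have sz := size_alive S_gt0 al.
pose dev e := avg_seq (weight q) n (event_total (replenish S (advance S pol zs e))) -
    n%:R * (price N vbar gamma - delta * g) + delta * v (replenish S (advance S pol zs e)).
have -> : avg (weight q) (fun e => avg_seq (weight q) n (fun es =>
      event_revenue zs e + event_total (replenish S (advance S pol zs e)) es)) -
    n.+1%:R * (price N vbar gamma - delta * g) + delta * v zs = avg (weight q) dev.
  (* Poisson equation: replenishment returns to the empty history, where [v] is 0, just as [value]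
     stops at a stock-out. *)
  have -> : v zs = avg (weight q) (fun e => r zs e + v (replenish S (advance S pol zs e))).
    rewrite /v (_ : (T - size zs = (T - (size zs).+1).+1)%N); last by rewrite subnSK.
    rewrite /=; congr avg; apply/funext => e; congr (_ + _).
    rewrite /replenish -/(stock S _); case: ifP => _; first by rewrite -/(v [::]) v0.
    by rewrite size_advance.
  rewrite -avgZ -[n.+1%:R * _](avg_cst w1) -avgB -avgD.
  apply: eq_avg => // e /weight_valid ve.
  rewrite avg_seqD avg_seq_cst// /dev /r.
  have -> : event_revenue zs e = price N vbar gamma - delta * opaque_sale R pol zs e.
    rewrite /event_revenue /opaque_sale; case: (pol zs && _); first by rewrite mulr1.
    by case/andP: ve; case: e.1.2 => // i _ _; rewrite mulr0 subr0.
  by rewrite -natr1; ring.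
have devB e : 0 < weight q e -> `|dev e| <= `|delta| * (T%:R * (1 + `|g|)).
  move=> /weight_valid ve; apply: IH; rewrite /replenish -/(stock S _).
  case: ifPn => so; first exact: alive_nil.
  by split=> //; exact: balanced_advance.
rewrite ler_norml; apply/andP; split; [apply: avg_ge_cst|apply: avg_le_cst] => // e;
  by move=> /devB; rewrite ler_norml => /andP[].
Qed.

(** The lower bound is Jensen's inequality; the upper one holds because a cycle lasts at most [T]
    periods. *)
Lemma mean_square_length :
  let m2 := avg_seq (weight q) T
    (fun es => (@gain R N S pol (fun _ _ => 1) [::] es) ^+ 2) in
  mean_length ^+ 2 <= m2 <= T%:R * mean_length.
Proof.
have w0 (e : event N) := weight_ge0 q_ge0 q_le1 e; have w1 := weight_sum1 q_ge0 q_le1 N_ge2.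
rewrite /mean_length -(avg_seq_gain S pol _ _ _ q_ge0 q_le1 N_ge2).
set f := gain S pol _ [::] => /=; set m := avg_seq _ _ f.
have gain_bound zs es : 0 <= @gain R N S pol (fun _ _ => 1) zs es <= (size es)%:R.
  elim: es zs => [|e es IH] zs /=; first by rewrite lexx.
  have /andP[? ?] := IH (advance S pol zs e); rewrite -natr1.
  have ? : 0 <= (size es)%:R :> R by [].
  by case: ifP => _; lra.
apply/andP; split; last first.
  rewrite -avg_seqZ; apply: le_avg_seq => // es szes _.
  have /andP[f0 fT] := gain_bound [::] es.
  by rewrite expr2 ler_wpM2r// (le_trans fT)// szes.
have -> : m ^+ 2 = avg_seq (weight q) T (fun es => 2 * m * f es + (- m ^+ 2)).
  by rewrite avg_seqD avg_seqZ avg_seq_cst// -/m; ring.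
apply: le_avg_seq => // es _ _.
by rewrite -subr_ge0 (_ : _ - _ = (f es - m) ^+ 2) ?sqr_ge0//; ring.
Qed.

End Renewal.

End Paths.

(** * Distances on the circle and the law of a customer *)

Section Circle.
Variables (R : realType) (N : nat).
Hypothesis N_gt0 : (0 < N)%N.

Let Nr_gt0 : 0 < N%:R :> R. Proof. by rewrite ltr0n. Qed.

Lemma locationE (i : 'I_N) : location R i = (i.+1 %% N)%:R / N%:R.
Proof.
rewrite /location; case: eqP => [->|iN]; first by rewrite modnn mul0r.
by rewrite modn_small// ltn_neqAle ltn_ord andbT; apply/eqP.
Qed.

Lemma location_inj (i j : 'I_N) : (i.+1 %% N = j.+1 %% N)%N -> i = j.
Proof.
have modE (k : 'I_N) : (k.+1 %% N = if k.+1 == N then 0 else k.+1)%N.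
  by case: eqP => [->|kN]; rewrite ?modnn// modn_small// ltn_neqAle ltn_ord andbT; apply/eqP.
rewrite !modE => ij; apply/val_inj/eq_add_S.
by move: ij; case: (i.+1 =P N) => [->|_]; case: (j.+1 =P N) => [->|_].
Qed.

Lemma circ_dist_antipode (x y : R) : 0 <= x -> x <= 1 -> 0 <= y -> y <= 1 / 2 ->
  circ_dist x y + circ_dist x (y + 1 / 2) = 1 / 2.
Proof.
move=> x0 x1 y0 y1; rewrite /circ_dist.
have [h1|h1] := ger0P (x - y); have [h2|h2] := ger0P (x - (y + 1 / 2));
by case: (leP _ (1 - _)) => h3; case: (leP _ (1 - _)) => h4; lra.
Qed.

Lemma circ_dist01 (x : R) : 0 <= x -> x <= 1 -> circ_dist x 1 = circ_dist x 0.
Proof.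
move=> x0 x1; rewrite /circ_dist subr0 (ger0_norm x0) ler0_norm ?subr_le0//.
by rewrite minC; congr (Num.min _ _); ring.
Qed.

(** For even [N] the locations form [N / 2] antipodal pairs, each contributing [1 / 2]. *)
Lemma sum_circ_dist (x : R) : ~~ odd N -> 0 <= x -> x <= 1 ->
  \sum_(i < N) circ_dist x (location R i) = N%:R / 4.
Proof.
move=> evN x0 x1.
have NE : N = (N./2 + N./2)%N by rewrite addnn halfK (negbTE evN) subn0.
have n0 : (0 < N./2)%N by lia.
have distE (i : 'I_N) : circ_dist x (location R i) = circ_dist x (i.+1%:R / N%:R).
  rewrite /location; case: eqP => // ->.
  by rewrite divff ?lt0r_neq0// circ_dist01.
rewrite (eq_bigr _ (fun i _ => distE i)).
rewrite -(big_mkord xpredT (fun i => circ_dist x (i.+1%:R / N%:R))).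
rewrite [in X in \sum_(0 <= i < X) _]NE (big_cat_nat (n := N./2))//= ?leq_addr//.
rewrite -{2}[N./2]add0n big_addn addnK -big_split/=.
rewrite (eq_big_nat _ _ (F2 := fun=> 1 / 2)) => [|i /andP[_ iN]].
  rewrite sumr_const_nat subn0 [in RHS]NE natrD -[_ *+ _]mulr_natr.
  by field.
have nE : N%:R = N./2%:R + N./2%:R :> R by rewrite -natrD -NE.
have nr0 : 0 < N./2%:R :> R by rewrite ltr0n.
rewrite -addSn natrD mulrDl (_ : N./2%:R / N%:R = 1 / 2); last by rewrite nE; field; lra.
apply: circ_dist_antipode => //.
rewrite nE ler_pdivrMr ?addr_gt0//.
have : i.+1%:R <= N./2%:R :> R by rewrite ler_nat.
lra.
Qed.

(** Half the spacing of the locations, that is, the radius of a nearest-location cell. *)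
Let half : R := 1 / (2 * N%:R).

Let halfE : N%:R^-1 = half + half.
Proof. by rewrite /half; field; rewrite lt0r_neq0. Qed.

Let nat_grid (m k : nat) : (m < k)%N -> m%:R / N%:R + (half + half) <= k%:R / N%:R.
Proof.
move=> mk; rewrite -halfE -[X in _ + X]mul1r -mulrDl ler_wpM2r ?invr_ge0//.
by rewrite natr1 ler_nat.
Qed.

Let half_gt0 : 0 < half.
Proof. by rewrite /half divr_gt0// mulr_gt0. Qed.

Lemma lt_circ_dist (t x y : R) :
  (x + t < y \/ y + t < x) -> x - y < 1 - t -> y - x < 1 - t ->
  t < circ_dist x y.
Proof.
by move=> xy ? ?; rewrite lt_min; have [] := ger0P (x - y) => ?; case: xy => ?; lra.
Qed.

Lemma right_cell (x : R) (i : 'I_N) (k := (i.+1 %% N)%N) :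
  k%:R / N%:R < x -> x < k%:R / N%:R + half ->
  circ_dist x (location R i) = x - k%:R / N%:R /\
  forall j, j != i -> half < circ_dist x (location R j).
Proof.
have kN : (k < N)%N by rewrite ltn_mod.
have h0 := half_gt0; have := nat_grid kN; rewrite divff ?lt0r_neq0// => k1.
have k0 : 0 <= k%:R / N%:R :> R by rewrite divr_ge0.
move=> xk kx; split=> [|j ji].
  rewrite locationE -/k /circ_dist ger0_norm; last by lra.
  by rewrite min_l//; lra.
rewrite locationE; set m := (j.+1 %% N)%N.
have mN : (m < N)%N by rewrite ltn_mod.
have := nat_grid mN; rewrite divff ?lt0r_neq0// => m1.
have m0 : 0 <= m%:R / N%:R :> R by rewrite divr_ge0.
have : m != k by apply: contra_neq ji => /location_inj.
rewrite neq_ltn => /orP[] /nat_grid => mk; apply: lt_circ_dist; lra.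
Qed.

(** The index is not reduced modulo [N] here: the left half-cell of the last product, located at 0,
    ends at 1. *)
Lemma left_cell (x : R) (i : 'I_N) :
  i%:R / N%:R + half < x -> x < i.+1%:R / N%:R ->
  circ_dist x (location R i) = i.+1%:R / N%:R - x /\
  forall j, j != i -> half < circ_dist x (location R j).
Proof.
have h0 := half_gt0; have iN := nat_grid (ltn_ord i).
have := nat_grid (ltnSn i).
rewrite divff ?lt0r_neq0// in iN *.
have i0 : 0 <= i%:R / N%:R :> R by rewrite divr_ge0.
have i1E : i.+1%:R / N%:R = i%:R / N%:R + (half + half).
  by rewrite -halfE -natr1 mulrDl mul1r.
move=> i1 xl xr; split=> [|j ji].
  rewrite /location; case: eqP => [iE|_].
    have i1E' : i.+1%:R / N%:R = 1 :> R by rewrite iE divff// lt0r_neq0.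
    rewrite i1E' in i1E xr *; rewrite /circ_dist subr0 ger0_norm; last by lra.
    by rewrite min_r//; lra.
  by rewrite /circ_dist ler0_norm ?opprB; [rewrite min_l//; lra|lra].
rewrite /location; case: eqP => [jE|jN].
  have iN1 : (i.+1 < N)%N.
    rewrite ltn_neqAle ltn_ord andbT; apply: contra_neqN ji => /eqP iE.
    by apply/val_inj/eq_add_S; rewrite iE.
  have := nat_grid iN1; rewrite divff ?lt0r_neq0// => ?.
  by apply: lt_circ_dist; lra.
have jN1 : (j.+1 < N)%N by rewrite ltn_neqAle ltn_ord andbT; apply/eqP.
have := nat_grid jN1; rewrite divff ?lt0r_neq0// => ?.
have := nat_grid (ltn0Sn j); rewrite mul0r add0r => ?.
have : j.+1 != i.+1 by apply: contra_neq ji => /eq_add_S/val_inj.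
by rewrite neq_ltn => /orP[] /nat_grid => ?; apply: lt_circ_dist; lra.
Qed.

End Circle.

(** * The choice of a customer inside a cell *)

Section Choice.
Variables (R : realType) (N : nat) (vbar gamma delta : R).
Hypotheses (N_gt0 : (0 < N)%N) (N_even : ~~ odd N) (gamma_gt0 : 0 < gamma).
Hypothesis delta_gt : (1 / 4 - 1 / (2 * N%:R)) * gamma < delta.

Lemma opaque_valuationE (x : R) : 0 <= x -> x <= 1 ->
  opaque_valuation N vbar gamma x = vbar - gamma / 4.
Proof.
move=> x0 x1; rewrite /opaque_valuation /valuation sumrB -mulr_sumr sum_circ_dist//.
rewrite sumr_const card_ord -[_ *+ N]mulr_natl; field.
by rewrite pnatr_eq0 -lt0n.
Qed.

Lemma buys_opaqueE (x : R) : 0 <= x -> x <= 1 ->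
  buys_opaque N vbar gamma delta true x =
  [forall i : 'I_N, 1 / 4 - delta / gamma <= circ_dist x (location R i)].
Proof.
move=> x0 x1; rewrite /buys_opaque opaque_valuationE//=.
have Nr0 : 0 < N%:R :> R by rewrite ltr0n.
have e1 : (1 / 4 - 1 / (2 * N%:R)) * gamma = gamma / 4 - gamma / (2 * N%:R) :> R.
  by field; rewrite lt0r_neq0.
have dgt := delta_gt; rewrite e1 in dgt.
have equiv i : (valuation vbar gamma x i - price N vbar gamma <=
    vbar - gamma / 4 - (price N vbar gamma - delta)) =
    (1 / 4 - delta / gamma <= circ_dist x (location R i)).
  rewrite -[RHS](ler_pM2l gamma_gt0).
  have -> : gamma * (1 / 4 - delta / gamma) = gamma / 4 - delta.
    by field; rewrite lt0r_neq0.
  by rewrite /valuation /price; apply/idP/idP; lra.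
apply/bigmax_leP/forallP => [[_ h] i|h]; first by rewrite -equiv h.
split=> [|i _]; last by rewrite equiv.
(* Against buying nothing: the opaque surplus [gamma / (2 * N) - gamma / 4 + delta] is positive by
   the lower bound on [delta]. *)
by rewrite /price; lra.
Qed.

(** Inside a cell the nearest product is the strict favourite, and its distance alone decides about
    the opaque product. *)
Lemma cell_choice (x r : R) (i : 'I_N) : 0 <= x -> x <= 1 ->
  circ_dist x (location R i) = r -> r < 1 / (2 * N%:R) ->
  (forall j, j != i -> 1 / (2 * N%:R) < circ_dist x (location R j)) ->
  (buys_opaque N vbar gamma delta true x, favourite N vbar gamma x) =
  (1 / 4 - delta / gamma <= r, Some i).
Proof.
move=> x0 x1 dr r_lt far.
have Nr0 : 0 < N%:R :> R by rewrite ltr0n.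
congr pair.
  rewrite buys_opaqueE//; apply/forallP/idP => [/(_ i)|h j]; rewrite ?dr//.
  have [->|ji] := eqVneq j i; first by rewrite dr.
  by rewrite (le_trans h)// (le_trans (ltW r_lt))// ltW// far.
have lt_val j : j != i -> valuation vbar gamma x j < valuation vbar gamma x i.
  move=> ji; rewrite /valuation ltrD2l ltrN2 ltr_pM2l// dr.
  exact: lt_trans r_lt (far j ji).
rewrite /favourite; case: pickP => [k /and3P[_ /forallP kmax _]|/(_ i)].
  have [->//|ki] := eqVneq k i.
  by have := lt_le_trans (lt_val _ ki) (kmax i); rewrite ltxx.
move=> /= /negbT/negP[]; apply/and3P; split.
- rewrite /valuation /price dr subr_ge0 lerD2l lerN2.
  have -> : gamma / (2 * N%:R) = gamma * (1 / (2 * N%:R)) by rewrite div1r.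
  by rewrite ler_pM2l// ltW.
- by apply/forallP => j; have [->//|/lt_val/ltW] := eqVneq j i.
- by apply/forallP => j; apply/implyP => ji; apply: lt_val; apply: contraTneq ji => ->; rewrite ltnn.
Qed.

End Choice.

(** * Measurability and law of the decisions *)

Lemma expectation_finite (d : measure_display) (T : measurableType d) (R : realType)
    (P : probability T R) (I : finType) (f : T -> I) (g : I -> R) :
  (forall i, measurable (f @^-1` [set i])) ->
  ('E_P[g \o f] = \sum_i (g i)%:E * P (f @^-1` [set i]))%E.
Proof.
move=> mf; rewrite unlock.
transitivity (\int[P]_w (\sum_i (g i)%:E * (\1_(f @^-1` [set i]) w)%:E))%E.
  apply: eq_integral => w _ /=.
  rewrite (bigD1 (f w))//= big1 ?adde0 => [|i iw]; rewrite indicE.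
    by rewrite mem_set// mule1.
  by rewrite memNset ?mule0// => /= wi; rewrite wi eqxx in iw.
rewrite integral_sum//=; last first.
  by move=> i; apply: integrableZl => //; exact: integrable_indic.
apply: eq_bigr => i _; rewrite integralZl//; last exact: integrable_indic.
by rewrite integral_indic// setIT.
Qed.

Lemma measurable_forall (d : measure_display) (T : measurableType d) (I : finType)
    (F : I -> T -> bool) :
  (forall i, measurable_fun setT (F i)) ->
  measurable_fun setT (fun x => [forall i, F i x]).
Proof.
move=> mF; apply: (measurable_fun_bool true); rewrite setTI.
rewrite (_ : _ @^-1` _ = \bigcap_(i in setT) (F i @^-1` [set true])).
  apply: fin_bigcap_measurable => [|i _]; first exact: finite_finset.
  by rewrite -[X in measurable X]setTI; exact: mF.
apply/seteqP; split=> x /=; first by move/forallP => h i _; exact: h.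
by move=> h; apply/forallP => i; exact: h.
Qed.

Lemma uniform_prob_itv (R : realType) (a b : R) : 0 <= a -> a <= b -> b <= 1 ->
  uniform_prob (@ltr01 R) `]a, b[%classic = (b - a)%:E.
Proof.
move=> a0 ab b1; rewrite /uniform_prob.
rewrite (eq_integral (fun=> 1%:E)) => [|x]; last first.
  rewrite inE/= in_itv/= => /andP[ax xb]; rewrite /uniform_pdf.
  by rewrite (le_trans a0 (ltW ax)) (le_trans (ltW xb) b1)/= subr0 invr1.
rewrite integral_cst//= mul1e lebesgue_measure_itv/= lte_fin.
have [_|ba] := ltP a b; first by rewrite EFinB.
by rewrite (_ : b - a = 0)//; apply/eqP; rewrite subr_eq0 eq_le ab ba.
Qed.

Section DecisionLaw.
Variables (R : realType) (N : nat) (vbar gamma delta : R).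

Definition decision (x : R) : bool * option 'I_N :=
  (buys_opaque N vbar gamma delta true x, favourite N vbar gamma x).

Lemma measurable_valuation (i : 'I_N) :
  measurable_fun setT (fun x : R => valuation vbar gamma x i).
Proof.
rewrite /valuation /circ_dist.
have mn : measurable_fun setT (fun x : R => `|x - location R i|).
  by apply: measurableT_comp => //; exact: measurable_funB.
apply: measurable_funB => //; apply: measurable_funM => //.
by apply: measurable_minr => //; exact: measurable_funB.
Qed.

Lemma measurable_opaque : measurable_fun setT (buys_opaque N vbar gamma delta true).
Proof.
pose v (x : R) := opaque_valuation N vbar gamma x - (price N vbar gamma - delta).
have mv : measurable_fun setT v.
  apply: measurable_funB => //; apply: measurable_funM => //.
  by apply: measurable_sum => i; exact: measurable_valuation.
have -> : buys_opaque N vbar gamma delta true = (fun x : R => (0 <= v x) &&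
    [forall i : 'I_N, valuation vbar gamma x i - price N vbar gamma <= v x]).
  apply/funext => x; rewrite /buys_opaque /=.
  apply/idP/andP => [/bigmax_leP[v0 vi]|[v0 /forallP vi]].
    by split=> //; apply/forallP => i; exact: vi.
  by apply/bigmax_leP; split=> // i _; exact: vi.
apply: measurable_and; first exact: measurable_fun_ler.
apply: measurable_forall => i; apply: measurable_fun_ler => //.
by apply: measurable_funB => //; exact: measurable_valuation.
Qed.

(** The lexicographic rule leaves at most one candidate, so [pick] has no freedom. *)
Lemma favouriteE (x : R) (i : 'I_N) : favourite N vbar gamma x = Some i <->
  [&& 0 <= valuation vbar gamma x i - price N vbar gamma,
      [forall j : 'I_N, valuation vbar gamma x j <= valuation vbar gamma x i] &
      [forall j : 'I_N, (j < i)%N ==>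
         (valuation vbar gamma x j < valuation vbar gamma x i)]].
Proof.
rewrite /favourite; split=> [|iP].
  by case: pickP => // k kP [<-].
case: pickP => [k kP|/(_ i)]; last by rewrite /= iP.
suff -> : k = i by [].
apply: ord_inj; apply: anti_leq; rewrite (leqNgt k) (leqNgt i).
move: kP iP => /and3P[_ /forallP kmax /forallP kfst] /and3P[_ /forallP imax /forallP ifst].
apply/andP; split; apply/negP => ki.
  by have := kfst i; rewrite ki ltNge imax.
by have := ifst k; rewrite ki ltNge kmax.
Qed.

Lemma measurable_favourite (o : option 'I_N) :
  measurable [set x : R | favourite N vbar gamma x = o].
Proof.
have mS i : measurable [set x : R | favourite N vbar gamma x = Some i].
  rewrite (eq_set (fun x => propext (favouriteE x i))).
  rewrite -[X in measurable X]setTI.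
  have mval := measurable_valuation.
  suff m : measurable_fun setT (fun x => [&& 0 <= valuation vbar gamma x i - price N vbar gamma,
      [forall j : 'I_N, valuation vbar gamma x j <= valuation vbar gamma x i] &
      [forall j : 'I_N, (j < i)%N ==>
         (valuation vbar gamma x j < valuation vbar gamma x i)]]).
    exact: (m _ [set true]).
  apply: measurable_and.
    by apply: measurable_fun_ler => //; exact: measurable_funB.
  apply: measurable_and; apply: measurable_forall => j; first exact: measurable_fun_ler.
  case: (j < i)%N => //=; exact: measurable_fun_ltr.
case: o => [i|]; first exact: mS.
rewrite (_ : [set _ | _] = ~` \bigcup_(i in setT) [set x : R | favourite N vbar gamma x = Some i]).
  apply: measurableC; apply: fin_bigcup_measurable => //; exact: finite_finset.
apply/seteqP; split=> x /=; first by move=> fN [i _] /=; rewrite fN.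
by case E : (favourite _ _ _ _) => [i|//] []; exists i.
Qed.

Lemma measurable_decision c : measurable (decision @^-1` [set c]).
Proof.
case: c => b o.
rewrite (_ : _ @^-1` _ = (buys_opaque N vbar gamma delta true @^-1` [set b]) `&`
    [set x : R | favourite N vbar gamma x = o]).
  apply: measurableI; last exact: measurable_favourite.
  by rewrite -[X in measurable X]setTI; exact: measurable_opaque.
by apply/seteqP; split=> x; rewrite /decision /= => -[-> ->].
Qed.

Hypotheses (N_gt0 : (0 < N)%N) (N_even : ~~ odd N) (gamma_gt0 : 0 < gamma).
Hypothesis delta_gt : (1 / 4 - 1 / (2 * N%:R)) * gamma < delta.
Hypothesis delta_le : delta <= gamma / 4.

Let Nr_gt0 : 0 < N%:R :> R. Proof. by rewrite ltr0n. Qed.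
Let half : R := 1 / (2 * N%:R).
(** The distance to the nearest location from which on the opaque product is preferred. *)
Let tau : R := 1 / 4 - delta / gamma.
Let mu := uniform_prob (@ltr01 R).
Let halfE : N%:R^-1 = half + half.
Proof. by rewrite /half; field; rewrite lt0r_neq0. Qed.
Let half_gt0 : 0 < half.
Proof. by rewrite /half divr_gt0// mulr_gt0. Qed.
Let half_le : half + half <= 1.
Proof. by rewrite -halfE invf_le1// ler1n. Qed.

Let tau_ge0 : 0 <= tau.
Proof. by rewrite /tau subr_ge0 ler_pdivrMr// mulrC mul1r. Qed.

Let tau_lt : tau < half.
Proof.
rewrite /tau ltrBlDl -ltrBlDr ltr_pdivlMr//.
Qed.

(** The points at distance between [u] and [v] from the location form two disjoint intervals of
    length [v - u], one on each side. *)
Lemma decision_mass_ge (u v : R) (b : bool) (i : 'I_N) :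
  0 <= u -> u <= v -> v <= half ->
  (forall r, u < r -> r < v -> (tau <= r) = b) ->
  ((2 * (v - u))%:E <= mu (decision @^-1` [set (b, Some i)]))%E.
Proof.
move=> u0 uv vh br.
set k := (i.+1 %% N)%N; set kr : R := k%:R / N%:R; set ir : R := i.+1%:R / N%:R.
have i1E : ir = i%:R / N%:R + (half + half) by rewrite /ir -halfE -natr1 mulrDl mul1r.
have i0 : 0 <= i%:R / N%:R :> R by rewrite divr_ge0.
have i1 : ir <= 1 by rewrite /ir ler_pdivrMr// mul1r ler_nat.
have k0 : 0 <= kr by rewrite divr_ge0.
have k1 : kr + (half + half) <= 1.
  by rewrite -halfE /kr -[X in _ + X]mul1r -mulrDl natr1 ler_pdivrMr// mul1r ler_nat ltn_mod.
have kir : kr = ir \/ kr = 0 /\ ir = 1.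
  rewrite /kr /ir /k; have [iN|iN] := eqVneq i.+1 N.
    by right; rewrite iN modnn mul0r divff// lt0r_neq0.
  by left; rewrite modn_small// ltn_neqAle iN ltn_ord.
pose I1 := `]kr + u, kr + v[%classic; pose I2 := `]ir - v, ir - u[%classic.
have sub : I1 `|` I2 `<=` decision @^-1` [set (b, Some i)].
  move=> x []; rewrite /I1 /I2 /= in_itv/= => /andP[xl xr].
    have [||dist far] := @right_cell R N N_gt0 x i; rewrite -/k -/kr -/half.
    - by lra.
    - by lra.
    have x0 : 0 <= x by lra.
    have x1 : x <= 1 by lra.
    have r_lt : x - kr < 1 / (2 * N%:R) by rewrite -/half; lra.
    have := cell_choice vbar N_gt0 N_even gamma_gt0 delta_gt x0 x1 dist r_lt far.
    by rewrite /decision => ->; rewrite -/tau -/k -/kr br//; lra.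
  have [||dist far] := @left_cell R N N_gt0 x i; rewrite -/ir -/half.
  - by lra.
  - by lra.
  have x0 : 0 <= x by lra.
  have x1 : x <= 1 by lra.
  have r_lt : ir - x < 1 / (2 * N%:R) by rewrite -/half; lra.
  have := cell_choice vbar N_gt0 N_even gamma_gt0 delta_gt x0 x1 dist r_lt far.
  by rewrite /decision => ->; rewrite -/tau -/ir br//; lra.
apply: (@le_trans _ _ (mu (I1 `|` I2))); last first.
  apply: le_measure => //; rewrite inE.
    by apply: measurableU; exact: measurable_itv.
  exact: measurable_decision.
rewrite /mu measureU; [|exact: measurable_itv|exact: measurable_itv|]; last first.
  apply/seteqP; split=> // x []; rewrite /I1 /I2 /= !in_itv/= => /andP[x1 x2] /andP[x3 x4].
  by case: kir => [|[]] *; lra.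
have e1 : uniform_prob (@ltr01 R) I1 = (v - u)%:E.
  by rewrite uniform_prob_itv; [congr EFin; ring|lra|lra|lra].
have e2 : uniform_prob (@ltr01 R) I2 = (v - u)%:E.
  by rewrite uniform_prob_itv; [congr EFin; ring|lra|lra|lra].
change ((2 * (v - u))%:E <= uniform_prob (@ltr01 R) I1 + uniform_prob (@ltr01 R) I2)%E.
rewrite e1 e2.
by rewrite -EFinD lee_fin; lra.
Qed.

(* It suffices to bound the masses from below, since the bounds sum to 1; thus
   neither ties nor the boundaries of the cells matter. *)
Lemma decision_law c :
  mu (decision @^-1` [set c]) =
  ((if c.1 then opaque_prob N gamma delta else 1 - opaque_prob N gamma delta) *
   (if c.2 is Some _ then N%:R^-1 else 0))%:E.
Proof.
set q := opaque_prob N gamma delta.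
pose w (c : bool * option 'I_N) : R :=
  (if c.1 then q else 1 - q) * (if c.2 is Some _ then N%:R^-1 else 0).
rewrite -/(w c).
have fin c' : mu (decision @^-1` [set c']) \is a fin_num.
  by apply: fin_num_measure; exact: measurable_decision.
pose m c' := fine (mu (decision @^-1` [set c'])).
have qE : 1 - q = 2 * N%:R * tau.
  by rewrite /q /opaque_prob /tau; field; rewrite lt0r_neq0.
have w_le c' : w c' <= m c'.
  case: c' => b [i|]; last by rewrite /w mulr0 fine_ge0.
  rewrite -lee_fin fineK// /w /=; case: b.
    apply: le_trans (@decision_mass_ge tau half true i tau_ge0 (ltW tau_lt) (lexx _) _).
      rewrite lee_fin (_ : q = 1 - 2 * N%:R * tau); last by lra.
      by rewrite /half le_eqVlt; apply/orP; left; apply/eqP; field; rewrite lt0r_neq0.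
    by move=> r /ltW.
  apply: le_trans (@decision_mass_ge 0 tau false i (lexx _) tau_ge0 (ltW tau_lt) _).
    by rewrite lee_fin qE le_eqVlt; apply/orP; left; apply/eqP; field; rewrite lt0r_neq0.
  by move=> r _ rt; rewrite leNgt rt.
have sum_w : \sum_c' w c' = 1.
  rewrite (eq_bigr (fun c' => w (c'.1, c'.2))) => [|[]//].
  rewrite -(pair_bigA _ (fun b o => w (b, o)))/= big_bool/=.
  have row b : \sum_(o : option 'I_N) w (b, o) = if b then q else 1 - q.
    rewrite (big_option (fun o => w (b, o))) /w /= mulr0 add0r -mulr_sumr.
    by rewrite sumr_const card_ord -[_ *+ N]mulr_natl divff ?mulr1// lt0r_neq0.
  by rewrite !row addrC subrK.
have sum_m : \sum_c' m c' = 1.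
  apply: EFin_inj; rewrite -sumEFin.
  transitivity ('E_mu[((fun=> 1%R) \o decision : R -> R)])%E; last exact: expectation_cst.
  rewrite expectation_finite; last exact: measurable_decision.
  by apply: eq_bigr => c' _; rewrite mul1e fineK.
(* Nonnegative differences with sum 0 all vanish. *)
have : \sum_c' (m c' - w c') = 0 by rewrite sumrB sum_m sum_w subrr.
move/psumr_eq0P => /(_ _ c isT) h.
by rewrite -[LHS]fineK// -/(m c); congr EFin; apply/eqP; rewrite -subr_eq0 h// => c' _; rewrite subr_ge0.
Qed.

End DecisionLaw.

(** * The random stream of customers *)

Section Stream.
Context {d : measure_display} {Omega : measurableType d} {R : realType}.
Variables (P : probability Omega R) (N : nat).
Variables (X : nat -> {RV P >-> R}) (F : nat -> Omega -> {set 'I_N}).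
Variables (vbar gamma delta : R).
Hypotheses (N_ge2 : (2 <= N)%N) (N_even : ~~ odd N) (stream : customer_stream X F).
Hypothesis gamma_gt0 : 0 < gamma.
Hypothesis delta_gt : (1 / 4 - 1 / (2 * N%:R)) * gamma < delta.
Hypothesis delta_le : delta <= gamma / 4.

Let q := opaque_prob N gamma delta.
Let ev (w : Omega) (k : nat) : event N := customer_event vbar gamma delta (X k w) (F k w).
Let N_gt0 : (0 < N)%N := ltnW N_ge2.

(** [q] is a positive multiple of the distance from [delta] to its lower bound. *)
Lemma opaque_prob_gt0 : 0 < q.
Proof.
have Nr0 : 0 < N%:R :> R by rewrite ltr0n.
rewrite /q /opaque_prob.
have -> : 1 - N%:R / 2 + 2 * N%:R * delta / gamma =
    (delta - (1 / 4 - 1 / (2 * N%:R)) * gamma) * (2 * N%:R / gamma).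
  by field; rewrite !lt0r_neq0.
by rewrite mulr_gt0 ?subr_gt0// divr_gt0// mulr_gt0.
Qed.

Lemma opaque_prob_le1 : q <= 1.
Proof.
have Nr0 : 0 < N%:R :> R by rewrite ltr0n.
rewrite /q /opaque_prob -subr_ge0.
have -> : 1 - (1 - N%:R / 2 + 2 * N%:R * delta / gamma) =
    (gamma / 4 - delta) * (2 * N%:R / gamma).
  by field; rewrite lt0r_neq0.
by rewrite mulr_ge0 ?subr_ge0// divr_ge0 ?(ltW gamma_gt0)// mulr_ge0.
Qed.

Let prefix n (w : Omega) : n.-tuple (event N) := map_tuple (ev w) (iota_tuple n 0).

Let tnth_prefix n w (k : 'I_n) : tnth (prefix n w) k = ev w k.
Proof. by rewrite tnth_map (tnth_nth 0%N) nth_iota. Qed.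

Let eq_events n w w' : (forall k, (k < n)%N -> ev w k = ev w' k) ->
  [seq ev w k | k <- iota 0 n] = [seq ev w' k | k <- iota 0 n].
Proof. by move=> ww'; apply/eq_in_map => k; rewrite mem_iota => /ww'. Qed.

Let prefixE n (t : n.-tuple (event N)) (e0 : event N) :
  prefix n @^-1` [set t] = \bigcap_(k in `I_n)
    (X k @^-1` (decision N vbar gamma delta @^-1` [set (nth e0 t k).1]) `&`
     F k @^-1` [set (nth e0 t k).2]).
Proof.
apply/seteqP; split=> w /=.
  move=> <- k kn; have /= := tnth_prefix w (Ordinal kn).
  rewrite (tnth_nth e0) /= => ->; by split.
move=> h; apply: eq_from_tnth => k; rewrite tnth_prefix (tnth_nth e0).
have [/= h1 h2] := h k (ltn_ord k).
by rewrite [RHS]surjective_pairing -h1 -h2.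
Qed.

Lemma measurable_prefix n t : measurable (prefix n @^-1` [set t]).
Proof.
have e0 : event N := (true, None, finset.set0).
rewrite (prefixE t e0); apply: fin_bigcap_measurable => [|k _]; first exact: finite_II.
have [_ mF _ _] := stream; apply: measurableI; last exact: mF.
rewrite -[X in measurable X]setTI; apply: measurable_funP => //.
exact: measurable_decision.
Qed.

Lemma prefix_law n (t : n.-tuple (event N)) :
  P (prefix n @^-1` [set t]) = (\prod_(k < n) weight q (tnth t k))%:E.
Proof.
have e0 : event N := (true, None, finset.set0).
have [unif _ pairs indep] := stream.
rewrite (prefixE t e0) indep; last by move=> k; exact: measurable_decision.
rewrite (big_morph EFin EFinM erefl); apply: eq_bigr => k _.
rewrite (tnth_nth e0) pairs -[P (X k @^-1` _)]/(distribution P (X k) _).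
rewrite unif; last exact: measurable_decision.
by rewrite decision_law// -EFinM.
Qed.

Lemma expectation_prefix n (f : seq (event N) -> R) :
  ('E_P[fun w => f [seq ev w k | k <- iota 0 n]] = (avg_seq (weight q) n f)%:E)%E.
Proof.
rewrite -[LHS]/('E_P[(fun t : n.-tuple (event N) => f t) \o prefix n])%E.
rewrite expectation_finite; last exact: measurable_prefix.
rewrite avg_seqE -sumEFin; apply: eq_bigr => t _.
by rewrite prefix_law -EFinM mulrC.
Qed.

(** Such a set is a finite union of fibres of [prefix n]. *)
Lemma measurable_determined n (A : set Omega) :
  (forall w w', (forall k, (k < n)%N -> ev w k = ev w' k) -> A w -> A w') ->
  measurable A.
Proof.
move=> det.
rewrite (_ : A = \bigcup_(t in [set t | exists2 w, A w & prefix n w = t])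
    prefix n @^-1` [set t]).
  by apply: fin_bigcup_measurable => [|t _]; [exact: finite_finset|exact: measurable_prefix].
apply/seteqP; split=> [w Aw|w [t [w' Aw' tE] /= wE]].
  by exists (prefix n w) => //; exists w.
apply: det Aw' => k kn.
by rewrite -(tnth_prefix w' (Ordinal kn)) -(tnth_prefix w (Ordinal kn)) tE wE.
Qed.

(** * Expectations over one cycle and the long-run revenue *)

Section Cycle.
Variables (pol : policy N) (S : nat).
Hypothesis S_gt0 : (0 < S)%N.
Let T := horizon N S.
Let len w := cycle_length vbar gamma delta pol S (X ^~ w) (F ^~ w).

(** The preimage is split by cycle length, each piece depending on finitely many events; length 0 is
    handled as a complement. *)
Lemma measurable_stopped (h : nat -> Omega -> R) :
  (forall m w w', (forall k, (k < m)%N -> ev w k = ev w' k) -> h m w = h m w') ->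
  measurable_fun setT (fun w => h (len w) w).
Proof.
move=> det _ A mA; rewrite setTI.
have mh m B : measurable (h m @^-1` B).
  by apply: (@measurable_determined m) => w w' ww' /=; rewrite (det m _ _ ww').
have mlen m : (0 < m)%N -> measurable [set w | len w = m].
  move=> m0; apply: (@measurable_determined m) => w w' ww' /=.
  have cycleE t : (t <= m)%N -> first_cycle vbar gamma delta pol S (X ^~ w) (F ^~ w) t =
      first_cycle vbar gamma delta pol S (X ^~ w') (F ^~ w') t.
    by move=> tm; apply: eq_first_cycle => k kt; apply: ww'; exact: leq_trans kt tm.
  have lenP u := @cycle_lengthP R N vbar gamma delta pol S (X ^~ u) (F ^~ u) m m0.
  rewrite /len => /(lenP w)[som nom]; apply/(lenP w'); rewrite -cycleE//; split=> // t tm.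
  by rewrite -cycleE 1?ltnW//; exact: nom.
have mlen0 : measurable [set w | len w = 0%N].
  rewrite (_ : [set _ | _] = ~` \bigcup_(m in [set m | (0 < m)%N]) [set w | len w = m]).
    apply: measurableC; apply: bigcup_measurable => m; exact: mlen.
  apply/seteqP; split=> w /=; first by move=> l0 [m /= m0]; rewrite l0 => m0'; rewrite -m0' in m0.
  by move=> nl; apply/eqP; rewrite -leqn0 leqNgt; apply/negP => l0; apply: nl; exists (len w).
rewrite (_ : _ @^-1` A = \bigcup_(m in setT) ([set w | len w = m] `&` h m @^-1` A)).
  apply: bigcup_measurable => m _; apply: measurableI => //.
  by case: m => [|m]; [exact: mlen0|exact: mlen].
by apply/seteqP; split=> w /=; [exists (len w)|move=> [m _ [/= -> ]]].
Qed.

Lemma ae_valid : {ae P, forall w, forall k, (k < T)%N -> valid (ev w k)}.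
Proof.
set bad := [set w | ~~ all (@valid N) [seq ev w k | k <- iota 0 T]].
have mbad : measurable bad.
  by apply: (@measurable_determined T) => w w' ww'; rewrite /bad /= (eq_events ww').
exists bad; split=> //; last first.
  move=> w; apply: contra_notP => /negP; rewrite negbK => /allP valw k kT.
  by apply: valw; apply: map_f; rewrite mem_iota.
rewrite -expectation_indic//.
have -> : \1_bad = (fun w => (~~ all (@valid N) [seq ev w k | k <- iota 0 T])%:R) :> (Omega -> R).
  by apply/funext => w; rewrite indicE; congr (nat_of_bool _)%:R; apply/idP/idP;
    [rewrite inE|move=> h; rewrite inE].
have q0 := ltW opaque_prob_gt0; have q1 := opaque_prob_le1.
have w0 (e : event N) := weight_ge0 q0 q1 e.
rewrite (expectation_prefix T (fun es => (~~ all (@valid N) es)%:R)).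
congr EFin; apply/eqP; rewrite eq_le; apply/andP.
rewrite -(avg_seq_cst (weight_sum1 q0 q1 N_ge2) T 0).
split; apply: le_avg_seq => // es _ /allP pos.
by rewrite (_ : all _ _) //; apply/allP => e /pos/weight_valid.
Qed.

(** Almost surely all events up to [T] are valid, so the stopped quantity is a function of the first
    [T] events. *)
Lemma expectation_stopped (h : nat -> Omega -> R) (f : seq (event N) -> R) :
  (forall m w w', (forall k, (k < m)%N -> ev w k = ev w' k) -> h m w = h m w') ->
  (forall w, (forall k, (k < T)%N -> valid (ev w k)) ->
     h (len w) w = f [seq ev w k | k <- iota 0 T]) ->
  ('E_P[fun w => h (len w) w] = (avg_seq (weight q) T f)%:E)%E.
Proof.
move=> det hf; rewrite -expectation_prefix unlock.
apply: ae_eq_integral => //.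
- by apply/measurable_EFinP; exact: measurable_stopped.
- apply/measurable_EFinP => _ A mA; rewrite setTI.
  by apply: (@measurable_determined T) => w w' ww' /=; rewrite (eq_events ww').
- by apply: filterS ae_valid => w valw _; rewrite hf.
Qed.

Lemma expectation_length :
  ('E_P[R_cycle X F vbar gamma delta pol S] =
   (value S pol q (fun _ _ => 1%R) T [::])%:E)%E.
Proof.
rewrite -(avg_seq_gain _ _ _ _ _ (ltW opaque_prob_gt0) opaque_prob_le1 N_ge2).
apply: (@expectation_stopped (fun m _ => m%:R)) => // w valw.
exact: cycle_length_gain.
Qed.

Lemma expectation_square_length :
  ('E_P[fun w => (R_cycle X F vbar gamma delta pol S w ^+ 2)%R] =
   (avg_seq (weight q) T
      (fun es => (@gain R N S pol (fun _ _ => 1%R) [::] es ^+ 2)%R))%:E)%E.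
Proof.
apply: (@expectation_stopped (fun m _ => m%:R ^+ 2)) => // w valw.
by congr (_ ^+ 2); exact: cycle_length_gain.
Qed.

Lemma expectation_purchases :
  ('E_P[M_cycle X F vbar gamma delta pol S] =
   (value S pol q (opaque_sale R pol) T [::])%:E)%E.
Proof.
rewrite -(avg_seq_gain _ _ _ _ _ (ltW opaque_prob_gt0) opaque_prob_le1 N_ge2).
apply: (@expectation_stopped (fun m w => (\sum_(t < m) (pol (first_cycle vbar gamma delta
   pol S (X ^~ w) (F ^~ w) t) && (ev w t).1.1))%:R)) => [m w w' ww'|w valw].
  congr _%:R; apply: eq_bigr => t _.
  rewrite ww'// (@eq_first_cycle _ _ _ _ _ _ _ _ (X ^~ w') _ (F ^~ w'))// => k kt.
  by apply: ww'; exact: ltn_trans kt (ltn_ord t).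
exact: opaque_purchases_gain.
Qed.

(** The mean total revenue deviates boundedly from a linear function, and division by [n] removes
    the deviation. *)
Lemma long_run_revenueE :
  long_run_revenue X F vbar gamma delta pol S
    (price N vbar gamma - delta * (value S pol q (opaque_sale R pol) T [::] /
                                   value S pol q (fun _ _ => 1) T [::])).
Proof.
rewrite /long_run_revenue; set r := price _ _ _ - _.
have [B HB] := event_total_linear vbar gamma delta pol (ltW opaque_prob_gt0)
  opaque_prob_le1 N_ge2 S_gt0.
pose m n := avg_seq (weight q) n (event_total vbar gamma delta pol S [::]).
rewrite (_ : (fun n => _) = (fun n => (m n / n%:R)%:E)); last first.
  apply/funext => n.
  have -> : (fun w => total_revenue vbar gamma delta pol S (X ^~ w) (F ^~ w) n / n%:R) =
      (fun w => event_total vbar gamma delta pol S [::] [seq ev w k | k <- iota 0 n] / n%:R).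
    by apply/funext => w; rewrite total_revenueE.
  rewrite (expectation_prefix n (fun es => event_total vbar gamma delta pol S [::] es / n%:R)).
  rewrite /m [in RHS]mulrC -avg_seqZ; congr ((avg_seq _ _ _)%:E).
  by apply/funext => es; rewrite mulrC.
apply/fine_cvgP; split; first exact: nearW.
apply/cvgrPdist_le => e e0.
near=> n.
have n0 : 0 < n%:R :> R by rewrite ltr0n; near: n; exact: nbhs_infty_gt.
rewrite /= -(ler_pM2r n0) -[X in _ * X <= _](gtr0_norm n0) -normrM mulrBl divfK ?lt0r_neq0//.
rewrite distrC [r * _]mulrC (le_trans (HB n))// -ler_pdivrMl//.
by near: n; exact: nbhs_infty_ger.
Unshelve. all: by end_near. Qed.

End Cycle.
End Stream.

(** * Asymptotics in the initial stock *)

Theorem theorem4 (R : realType) (d : measure_display)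
    (Omega : measurableType d) (P : probability Omega R)
    (N : nat) (X : nat -> {RV P >-> R}) (F : nat -> Omega -> {set 'I_N})
    (vbar gamma delta c : R) (K h : nat -> R) :
  (2 <= N)%N -> ~~ odd N ->
  customer_stream X F ->
  0 < gamma -> gamma <= vbar * N%:R -> gamma / 4 < vbar ->
  (1 / 4 - 1 / (2 * N%:R)) * gamma < delta ->
  delta <= Num.min (gamma / 4) (price N vbar gamma) ->
  0 < c -> c <= 1 / (10 * 'C(N, 2)%:R) ->
  (forall S, (0 < S)%N -> 0 < K S) ->
  (forall S, (0 < S)%N -> 0 < h S) ->
  K \is 'Theta_\oo (fun S => S%:R : R) ->
  h \is 'Theta_\oo (fun S => S%:R^-1 : R) ->
  let q := opaque_prob N gamma delta in
  let pol S := @semi_dynamic R N q c S in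
  let ER S := mean P (R_cycle X F vbar gamma delta (pol S) S) in
  let EM S := mean P (M_cycle X F vbar gamma delta (pol S) S) in
  (EM =O_\oo (fun S => Num.sqrt S%:R : R) /\
   exists theta : nat -> R,
     (forall S, (0 < S)%N -> ER S = N%:R * S%:R - theta S) /\
     theta =O_\oo (fun _ => 1 : R)) /\
  exists xi1 xi2 : nat -> R,
    [/\ forall S, (0 < S)%N ->
          long_run_revenue X F vbar gamma delta (pol S) S
            (price N vbar gamma
             - delta * (1 - N%:R / 2 + 2 * N%:R * delta / gamma) * xi1 S),
        forall S, (0 < S)%N ->
          inventory_cost X F vbar gamma delta (pol S) S (K S) (h S)
          = K S / (N%:R * S%:R) + h S / 2 * (N%:R * S%:R) + xi2 S,
        xi1 =O_\oo (fun S => (Num.sqrt S%:R)^-1 : R) &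
        xi2 =O_\oo (fun S => S%:R^-1 : R)].

Proof.
move=> N2 Neven stream g0 _ _ dgt dle c0 c_le Kpos hpos KTheta hTheta q pol ER EM.
have {}dle : delta <= gamma / 4 by move: dle; rewrite le_min => /andP[].
have q0 : 0 < q := opaque_prob_gt0 N2 g0 dgt.
have q1 : q <= 1 := opaque_prob_le1 N2 g0 dle.
have N1 : 1 < N%:R :> R by rewrite ltr1n.
pose r S := value S (pol S) q (fun _ _ => 1) (horizon N S) [::] : R.
pose m S := value S (pol S) q (opaque_sale R (pol S)) (horizon N S) [::] : R.
have ERE S : (0 < S)%N -> ER S = r S.
  by move=> S0; rewrite /ER /mean expectation_length.
have EME S : (0 < S)%N -> EM S = m S.
  by move=> S0; rewrite /EM /mean expectation_purchases.
have TE S : (0 < S)%N -> (horizon N S)%:R = N%:R * S%:R - N%:R + 1 :> R.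
  by move=> S0; rewrite /horizon natrD natrM natrB// mulrBr mulr1.
(* Bounds [N * S] minus the mean length; the term [N] covers the difference between [N * S] and the
   horizon. *)
pose D : R := N%:R + `|shortfall N q c|.
have r_ge1 S : (0 < S)%N -> 1 <= r S.
  by move=> S0; apply: mean_length_ge1 => //; exact: ltW.
have r_le S : (0 < S)%N -> r S <= N%:R * S%:R - N%:R + 1.
  move=> S0; rewrite -TE//; apply: le_trans (ler_norm _) _; rewrite -[leRHS]mulr1.
  by apply: value_bound => //; [exact: ltW|move=> *; rewrite normr1].
have r_ge S : (0 < S)%N -> N%:R * S%:R - D <= r S.
  move=> S0; have := mean_length_ge N2 S0 q0 q1 c0 c_le; rewrite TE//.
  have := ler_norm (shortfall N q c); rewrite -/(pol S) -/(r S) /D; lra.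
pose A : R := N%:R / (c * q) * (5 / 4 * Num.sqrt N%:R).
have A0 : 0 < A.
  by rewrite /A mulr_gt0 ?divr_gt0 ?mulr_gt0 ?sqrtr_gt0//; lra.
have m_ge0 S : 0 <= m S.
  by apply: value_ge0 => //; exact: ltW.
have m_le S : (0 < S)%N -> m S <= A * Num.sqrt S%:R.
  move=> S0; apply: (le_trans (mean_opaque_sales_le N2 S0 q0 q1 c0 c_le)).
  rewrite /A -!mulrA ler_wpM2l// ler_wpM2l ?invr_ge0 ?mulr_ge0 ?(ltW c0) ?(ltW q0)//.
  rewrite ler_wpM2l// ler_wpM2l ?invr_ge0// -sqrtrM// ler_wsqrtr// TE//; lra.
have D0 : 0 < D by rewrite /D ltr_wpDr//; lra.
(* As [N >= 2], [N * S - D] exceeds [S] once [S >= D]. *)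
have r_geS : \forall S \near \oo, S%:R <= r S.
  near=> S.
  have S0 : (0 < S)%N by near: S; exact: nbhs_infty_gt.
  apply: le_trans (r_ge S S0).
  have SD : D <= S%:R by near: S; exact: nbhs_infty_ger.
  have : 2%:R * S%:R <= N%:R * S%:R :> R by rewrite ler_wpM2r// ler_nat.
  lra.
have /eqO_exP[kK kK0 HK] : K =O_\oo (fun S => S%:R : R).
  by move: KTheta; rewrite bigThetaE => -[].
have /eqO_exP[kh kh0 Hh] : h =O_\oo (fun S => S%:R^-1 : R).
  by move: hTheta; rewrite bigThetaE => -[].
split; first split.
- apply/eqO_exP; exists A => //; near=> S.
  have S0 : (0 < S)%N by near: S; exact: nbhs_infty_gt.
  by rewrite EME// !ger0_norm ?sqrtr_ge0// m_le.
- exists (fun S => N%:R * S%:R - ER S); split; first by move=> S _; rewrite subKr.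
  apply/eqO_exP; exists D => //; near=> S.
  have S0 : (0 < S)%N by near: S; exact: nbhs_infty_gt.
  rewrite ERE// normr1 mulr1 ger0_norm; last by have := r_le S S0; lra.
  by have := r_ge S S0; lra.
(* [xi1] is divided by [q] because the stated revenue carries that factor; [xi2] is the exact
   remainder. *)
exists (fun S => m S / r S / q), (fun S =>
  inventory_cost X F vbar gamma delta (pol S) S (K S) (h S) -
  (K S / (N%:R * S%:R) + h S / 2 * (N%:R * S%:R))); split.
- move=> S S0; rewrite -/(opaque_prob N gamma delta) -/q -mulrA.
  rewrite [q * _]mulrC divfK ?lt0r_neq0//; exact: long_run_revenueE.
- by move=> S _; rewrite addrC subrK.
- apply/eqO_exP; exists (A / q); first exact: divr_gt0.
  near=> S.
  have S0 : (0 < S)%N by near: S; exact: nbhs_infty_gt.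
  have Sr : 0 < S%:R :> R by rewrite ltr0n.
  have rS : S%:R <= r S by near: S.
  have sS : 0 < Num.sqrt S%:R :> R by rewrite sqrtr_gt0.
  have r0 : 0 < r S := lt_le_trans Sr rS.
  rewrite !ger0_norm ?divr_ge0 ?invr_ge0 ?(ltW sS) ?(ltW r0) ?(ltW q0)//.
  rewrite [leRHS]mulrAC ler_wpM2r ?invr_ge0 ?(ltW q0)//.
  apply: (@le_trans _ _ (A * Num.sqrt S%:R / S%:R)).
    by rewrite ler_pM ?invr_ge0 ?(ltW r0) ?m_le// lef_pV2.
  rewrite -{2}(sqr_sqrtr (ltW Sr)) le_eqVlt; apply/orP; left; apply/eqP; field.
  by rewrite lt0r_neq0.
- apply/eqO_exP; exists (kK * D + kh * (1 + D)); first by rewrite addr_gt0// mulr_gt0// addr_gt0.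
  near=> S.
  have S0 : (0 < S)%N by near: S; exact: nbhs_infty_gt.
  have Sr : 0 < S%:R :> R by rewrite ltr0n.
  have rS : S%:R <= r S by near: S.
  have r0 : 0 < r S := lt_le_trans Sr rS.
  have KS : K S <= kK * S%:R.
    apply: le_trans (ler_norm _) _; rewrite -[in leRHS](ger0_norm (ltW Sr)); by near: S.
  have hS : h S <= kh * S%:R^-1.
    have Si : 0 <= S%:R^-1 :> R by rewrite invr_ge0 ltW.
    apply: le_trans (ler_norm _) _; rewrite -[in leRHS](ger0_norm Si); by near: S.
  have K0 := Kpos S S0; have h0 := hpos S S0.
  have NS0 : 0 < N%:R * S%:R :> R by rewrite mulr_gt0//; lra.
  rewrite /inventory_cost /mean expectation_length// expectation_square_length//.
  rewrite -/(pol S) -/(r S).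
  have := mean_square_length (pol S) S (ltW q0) q1 N2.
  rewrite -/q -/(r S); set m2 := avg_seq _ _ _ => /andP[m2_ge m2_le].
  rewrite /= -/(r S).
  set u := m2 / r S.
  (* The ratio [u] of the second to the first moment lies between the mean length and the horizon,
     so [N * S + 1 - u] is in [[0, 1 + D]]. *)
  have u_ge : r S <= u by rewrite ler_pdivlMr// -expr2.
  have u_le : u <= N%:R * S%:R - N%:R + 1 by rewrite ler_pdivrMr// -TE.
  have d0 : 0 <= N%:R * S%:R - r S by have := r_le S S0; lra.
  have dD : N%:R * S%:R - r S <= D by have := r_ge S S0; lra.
  (* The first term is of order [S * D / S ^ 2], the second of order [(1 + D) / S]. *)
  rewrite (_ : _ - _ = K S * (N%:R * S%:R - r S) / (r S * (N%:R * S%:R)) +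
     h S / 2 * (N%:R * S%:R + 1 - u)); last first.
    by field; rewrite !lt0r_neq0//; lra.
  rewrite ger0_norm; last first.
    rewrite addr_ge0 ?divr_ge0 ?mulr_ge0 ?(ltW K0) ?(ltW h0) ?(ltW r0) ?(ltW NS0)//.
    by lra.
  rewrite ger0_norm ?invr_ge0 ?(ltW Sr)// mulrDl; apply: lerD.
    apply: (@le_trans _ _ (kK * S%:R * D / (S%:R * S%:R))).
      rewrite ler_pM ?mulr_ge0 ?invr_ge0 ?(ltW K0) ?(ltW r0) ?(ltW NS0)//.
      - by rewrite mulr_ge0 ?(ltW r0) ?(ltW NS0).
      - by rewrite ler_pM// ltW.
      rewrite lef_pV2 ?posrE; [|exact: mulr_gt0|exact: mulr_gt0].
      by apply: ler_pM => //; rewrite ?ler_peMl// ltW.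
    by rewrite le_eqVlt; apply/orP; left; apply/eqP; field; rewrite lt0r_neq0.
  rewrite [leRHS]mulrAC; apply: ler_pM; [by rewrite divr_ge0 ?(ltW h0)|lra| |lra].
  by apply: le_trans hS; lra.
Unshelve. all: by end_near. Qed.
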